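(* Let $\Omega\subset\mathbb R^N$ be a bounded and convex domain, let $\mu\in\mathcal P(\Omega\times\{0,1\})$ be a probability measure, and let $\varrho_i:=\mu(\,\cdot\,\times\{i\})$ for $i=0,1$ be absolutely continuous with respect to the Lebesgue measure $\lambda^N$ (with densities again denoted $\varrho_0,\varrho_1$). Let $u\in L^\infty(\Omega)$. Then $\mu^*\in\partial\mathrm{TV}_\varepsilon(u)$ if and only if (a) $\mu^*\in ba(\Omega,\mathfrak B_\Omega,\lambda^N)$, (b) $\mathrm{TV}_\varepsilon(u)=\int_\Omega u\,\mathrm d\mu^*$, and (c) there exists a net $(\boldsymbol\Psi_\alpha)_{\alpha\in D}$ in $\mathfrak P\times\mathfrak P$ such that $$-\int_\Omega v\,\mathrm{div}_\varepsilon[\boldsymbol\Psi_\alpha;\boldsymbol\varrho]\,\mathrm dx\to\int_\Omega v\,\mathrm d\mu^*\qquad\text{for all }v\in L^\infty(\Omega).$$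
   Context: Fix $\varepsilon>0$; $\mathrm B_\varepsilon(x)=\{y\in\mathbb R^N:|x-y|<\varepsilon\}$ with closure $\overline{\mathrm B}_\varepsilon(x)$. Define on $L^\infty(\Omega)$ $$\mathrm{TV}_\varepsilon(u)=\int_\Omega\frac{\operatorname{ess\,sup}_{\mathrm B_\varepsilon(x)\cap\Omega}u-u(x)}{\varepsilon}\varrho_0(x)\,\mathrm dx+\int_\Omega\frac{u(x)-\operatorname{ess\,inf}_{\mathrm B_\varepsilon(x)\cap\Omega}u}{\varepsilon}\varrho_1(x)\,\mathrm dx$$ (ess sup/inf with respect to Lebesgue measure). The subdifferential is taken in the dual of $L^\infty(\Omega)$: $\mu^*\in\partial\mathrm{TV}_\varepsilon(u)$ iff $\mathrm{TV}_\varepsilon(u)+\langle\mu^*,v-u\rangle\le\mathrm{TV}_\varepsilon(v)$ for all $v\in L^\infty(\Omega)$. The dual $L^\infty(\Omega)^*$ is identified with $ba(\Omega,\mathfrak B_\Omega,\lambda^N)$, the space of finitely additive finite signed measures on the Borel $\sigma$-algebra $\mathfrak B_\Omega$ that are absolutely continuous with respect to (vanish on null sets of) the Lebesgue measure $\lambda^N$, with pairing $\langle\mu^*,v\rangle=\int_\Omega v\,\mathrm d\mu^*$. $\mathfrak P$ is the set of $\Psi\in L^1(\Omega\times\Omega)$ with $\Psi\ge0$ a.e. on $\Omega\times\Omega$ and (for a representative) $\int_\Omega\Psi(x,y)\,\mathrm dy=1$ and $\operatorname{ess\,supp}\Psi(x,\cdot)\subset\overline{\mathrm B}_\varepsilon(x)\cap\overline\Omega$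 for $x\in\Omega$. For $f\in L^1(\Omega\times\Omega)$, $\mathrm{div}_\varepsilon[f](y)=\int_{\mathrm B_\varepsilon(y)\cap\Omega}\frac{f(y,x)-f(x,y)}{\varepsilon}\,\mathrm dx$. For $\boldsymbol\Psi=(\Psi_0,\Psi_1)$ and $\boldsymbol\varrho=(\varrho_0,\varrho_1)$, $[\boldsymbol\Psi;\boldsymbol\varrho](x,y):=\Psi_0(x,y)\varrho_0(x)-\Psi_1(x,y)\varrho_1(x)$, and $\mathrm{div}_\varepsilon[\boldsymbol\Psi;\boldsymbol\varrho]$ means $\mathrm{div}_\varepsilon$ applied to this function. *)

(* Defs.v *)
From HB Require Import structures.
From mathcomp Require Import all_boot all_order all_algebra.
From mathcomp Require Import all_classical all_reals all_analysis.
From mathcomp Require Import measurable_realfun ess_sup_inf.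

Set Implicit Arguments.
Unset Strict Implicit.
Unset Printing Implicit Defensive.

Import Order.TTheory GRing.Theory Num.Theory.
Import numFieldNormedType.Exports.
Import HBSimple.

Local Open Scope classical_set_scope.
Local Open Scope ring_scope.

HB.instance Definition _ (R : realType) (n : nat) :=
  @isMeasurable.Build (sigma_display (@open 'rV[R]_n)) 'rV[R]_n
    <<s @open 'rV[R]_n >>
    (@sigma_algebra0 _ setT (@open 'rV[R]_n))
    (@sigma_algebraC _ (@open 'rV[R]_n))
    (@sigma_algebra_bigcup _ setT (@open 'rV[R]_n)).

Lemma open_measurable_rV (R : realType) (n : nat) (A : set 'rV[R]_n) :
  open A -> measurable A.
Proof. exact: sub_sigma_algebra. Qed.

Lemma measurable_coord (R : realType) (n : nat) (j : 'I_n) :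
  measurable_fun [set: 'rV[R]_n] (fun x : 'rV[R]_n => x 0 j).
Proof.
apply: (measurability _ (RGenOpens.measurableE R)) => _ [_ [a [b ->] <-]].
rewrite setTI; apply: open_measurable_rV.
have /continuousP := @coord_continuous R 1 n 0 j; apply.
exact: interval_open.
Qed.

Lemma open_rational_balls (R : realType) (n : nat) (U : set 'rV[R]_n) :
  open U -> U = \bigcup_(c in [set c : 'rV[rat]_n * nat |
    [set x : 'rV[R]_n | forall j, `|x 0 j - ratr (c.1 0 j)| < c.2.+1%:R^-1]
      `<=` U])
    [set x : 'rV[R]_n | forall j, `|x 0 j - ratr (c.1 0 j)| < c.2.+1%:R^-1].
Proof.
move=> oU; apply/seteqP; split => [x Ux|x [c cU cx]]; last exact: cU.
have /nbhs_ballP[e /= e0 xeU] : nbhs x U by exact: open_nbhs_nbhs.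
have [k ke] : exists k : nat, 2 * k.+1%:R^-1 < e.
  have /ltr_add_invr[k] : 0 < e / 2 by rewrite divr_gt0.
  by rewrite add0r ltr_pdivlMr// mulrC => ?; exists k.
have k0 : (0 : R) < k.+1%:R^-1 by rewrite invr_gt0.
have /choice[q qx] : forall j : 'I_n, exists q : rat,
    `|x 0 j - ratr q| < k.+1%:R^-1.
  move=> j; have : x 0 j - k.+1%:R^-1 < x 0 j + k.+1%:R^-1.
    by rewrite ltrBlDr -addrA ltrDl addr_gt0.
  move=> /rat_in_itvoo[q]; rewrite in_itv/= => /andP[q1 q2]; exists q.
  by rewrite distrC ltr_distl q1.
exists (\row_j q j, k); last by move=> j /=; rewrite mxE.
move=> y /= yq; apply: xeU; rewrite -ball_normE/= /Num.norm/= mx_normrE.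
apply: bigmax_lt => // -[i j] _ /=; rewrite !ord1 !mxE.
have := yq j; rewrite mxE => yqj; apply: lt_trans ke.
rewrite (_ : _ - _ = (x 0 j - ratr (q j)) - (y 0 j - ratr (q j))).
  by rewrite (le_lt_trans (ler_normB _ _))// mulr_natl mulr2n ltrD.
by rewrite opprB addrA subrK.
Qed.

Lemma measurable_fun_rV d (T : measurableType d) (R : realType) (n : nat)
    (f : T -> 'rV[R]_n) :
  (forall j, measurable_fun [set: T] (fun t => f t 0 j)) ->
  measurable_fun [set: T] f.
Proof.
move=> mf; apply: (measurability (@open 'rV[R]_n)) => // _ [U oU <-].
rewrite (open_rational_balls oU) setTI preimage_bigcup bigcup_mkcond.
apply: countable_bigcupT_measurable => // -[q k]; case: ifPn => // _.
rewrite (_ : _ @^-1` _ = \bigcap_(j in [set: 'I_n])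
    ([set: T] `&` (fun t => f t 0 j) @^-1`
      (ball (ratr (q 0 j) : R) (k.+1%:R^-1)))); last first.
  apply/seteqP; split => t /=.
    by move=> h j _; split => //; rewrite -ball_normE/= distrC; exact: h.
  by move=> h j; have [_] := h j I; rewrite -ball_normE/= distrC.
apply: fin_bigcap_measurable => // j _; apply: mf => //.
by apply: open_measurable; exact: ball_open.
Qed.

Definition cons_rV (R : realType) (n : nat)
    (p : measurableTypeR R * 'rV[R]_n) : 'rV[R]_n.+1 :=
  row_mx (\row_(j < 1) p.1) p.2 : 'rV[R]_(1 + n).

Lemma measurable_cons_rV (R : realType) (n : nat) :
  measurable_fun [set: measurableTypeR R * 'rV[R]_n] (@cons_rV R n).
Proof.
apply: measurable_fun_rV => j; rewrite /cons_rV.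
have -> : j = unsplit (fintype.split (j : 'I_(1 + n))) :> 'I_(1 + n).
  by rewrite splitK.
case: (fintype.split _) => k /=.
  under eq_fun do rewrite (@row_mxEl _ _ 1 n) mxE.
  exact: measurable_fst.
under eq_fun do rewrite (@row_mxEr _ _ 1 n).
exact: measurableT_comp (measurable_coord k) (@measurable_snd _ _ _ _).
Qed.

Definition uncons_rV (R : realType) (n : nat) (x : 'rV[R]_n.+1) :
    measurableTypeR R * 'rV[R]_n :=
  (x 0 0, rsubmx (x : 'rV[R]_(1 + n))).

Lemma cons_rVK (R : realType) (n : nat) : cancel (@cons_rV R n) (@uncons_rV R n).
Proof.
case=> a t; rewrite /cons_rV /uncons_rV/= row_mxKr; congr pair.
have -> : (0 : 'I_n.+1) = lshift n (0 : 'I_1) :> 'I_(1 + n) by exact: val_inj.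
by rewrite (@row_mxEl _ _ 1 n) mxE.
Qed.

Lemma measurable_uncons_rV (R : realType) (n : nat) :
  measurable_fun [set: 'rV[R]_n.+1] (@uncons_rV R n).
Proof.
apply/measurable_fun_pairP; split; first exact: measurable_coord.
apply: measurable_fun_rV => j /=.
under eq_fun do rewrite /= mxE.
exact: measurable_coord.
Qed.

Section lebesgue_rV_step.
Local Open Scope ereal_scope.
Context (R : realType) (n : nat)
  (m : {sigma_finite_measure set 'rV[R]_n -> \bar R}).

Definition lebesgue_rV_step : set 'rV[R]_n.+1 -> \bar R :=
  pushforward (lebesgue_measure \x m) (@cons_rV R n).

Let mcons (A : set 'rV[R]_n.+1) :
  measurable A -> measurable (@cons_rV R n @^-1` A).
Proof. by move=> mA; rewrite -[X in measurable X]setTI; exact: measurable_cons_rV. Qed.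

Let step0 : lebesgue_rV_step set0 = 0.
Proof. by rewrite /lebesgue_rV_step /pushforward preimage_set0 measure0. Qed.

Let step_ge0 A : 0 <= lebesgue_rV_step A.
Proof. by rewrite /lebesgue_rV_step /pushforward measure_ge0. Qed.

Let step_sigma_additive : semi_sigma_additive lebesgue_rV_step.
Proof.
move=> F mF tF mUF; rewrite /lebesgue_rV_step /pushforward preimage_bigcup.
apply: measure_semi_sigma_additive.
- by move=> i; exact: mcons.
- apply/trivIsetP => /= i j _ _ ij; rewrite -preimage_setI.
  by move/trivIsetP : tF => /(_ _ _ _ _ ij) ->//; rewrite preimage_set0.
- by rewrite -preimage_bigcup; exact: mcons.
Qed.

HB.instance Definition _ := isMeasure.Build _ _ _ lebesgue_rV_step
  step0 step_ge0 step_sigma_additive.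

Let step_sigma_finite : sigma_finite [set: 'rV[R]_n.+1] lebesgue_rV_step.
Proof.
have /sigma_finiteP[F [TF ndF Foo]] := sigma_finiteT (@lebesgue_measure R).
have /sigma_finiteP[G [TG ndG Goo]] := sigma_finiteT m.
exists (fun k => @uncons_rV R n @^-1` (F k `*` G k)).
  apply/seteqP; split => // x _.
  have [i _ Fi] : (\bigcup_i F i) (uncons_rV x).1 by rewrite -TF.
  have [j _ Gj] : (\bigcup_i G i) (uncons_rV x).2 by rewrite -TG.
  exists (maxn i j) => //; split => /=.
    by move: Fi; apply/subsetPset/ndF/leq_maxl.
  by move: Gj; apply/subsetPset/ndG/leq_maxr.
move=> k; have [mF Fk] := Foo k; have [mG Gk] := Goo k; split.
  rewrite -[X in measurable X]setTI; apply: measurable_uncons_rV => //.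
  exact: measurableX.
rewrite /lebesgue_rV_step /pushforward -comp_preimage.
rewrite (_ : _ \o _ = id); last by apply/funext => x /=; rewrite cons_rVK.
by rewrite preimage_id product_measure1E// lte_mul_pinfty// ge0_fin_numE.
Qed.

HB.instance Definition _ := Measure_isSigmaFinite.Build _ _ _
  lebesgue_rV_step step_sigma_finite.

End lebesgue_rV_step.

(* N-dimensional Lebesgue measure on the Borel sets: the N-fold product of the
   one-dimensional one, transported along R * R^n ~ R^(n+1). *)
Fixpoint lebesgue_rV (R : realType) (n : nat) :
    {sigma_finite_measure set 'rV[R]_n -> \bar R} :=
  match n with
  | 0%N => \d_(0 : 'rV[R]_0)
  | m.+1 => lebesgue_rV_step (lebesgue_rV R m)
  end.

(* Euclidean norm: the norm of 'rV[R]_N in the library is the maximum norm. *)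
Definition enorm (R : realType) (N : nat) (x : 'rV[R]_N) : R :=
  Num.sqrt (\sum_j x 0 j ^+ 2).

Definition eball (R : realType) (N : nat) (x : 'rV[R]_N) (r : R) :
    set 'rV[R]_N :=
  [set y | enorm (x - y) < r].

Lemma measurable_eball (R : realType) (N : nat) (x : 'rV[R]_N) (r : R) :
  measurable (eball x r).
Proof.
have menorm : measurable_fun [set: 'rV[R]_N] (fun y => enorm (x - y)).
  apply: (measurableT_comp (f := @Num.sqrt R)).
    by apply: continuous_measurable_fun; exact: sqrt_continuous.
  apply: measurable_sum => j; apply: measurable_funX.
  under eq_fun do rewrite !mxE.
  by apply: measurable_funB => //; exact: measurable_coord.
rewrite (_ : eball x r =
  [set: 'rV[R]_N] `&` (fun y => enorm (x - y)) @^-1` `]-oo, r[%classic).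
  exact: menorm.
by rewrite setTI; apply/seteqP; split => y /=; rewrite in_itv.
Qed.

Section nonlocal_total_variation.
Context (R : realType) (N : nat).
Local Notation T := 'rV[R]_N.
Local Notation leb := (lebesgue_rV R N).

Definition domain (Omega : set T) :=
  [/\ open Omega, connected Omega & Omega !=set0].

Definition lebesgue_on (Omega : set T) (mOmega : measurable Omega) :
    {measure set T -> \bar R} :=
  mrestr leb mOmega.

Definition Linfty (Omega : set T) (mOmega : measurable Omega) :=
  LfunType (lebesgue_on mOmega) (leey 1%:E).

Definition ess_sup_eball (eps : R) (Omega : set T) (mOmega : measurable Omega)
    (v : T -> R) (x : T) : R :=
  fine (ess_sup (mrestr (lebesgue_on mOmega) (measurable_eball x eps))
    (EFin \o v)).

Definition ess_inf_eball (eps : R) (Omega : set T) (mOmega : measurable Omega)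
    (v : T -> R) (x : T) : R :=
  fine (ess_inf (mrestr (lebesgue_on mOmega) (measurable_eball x eps))
    (EFin \o v)).

(* The index set {0, 1} is bool, with false for 0 and true for 1. *)
Definition TV (eps : R) (Omega : set T) (mOmega : measurable Omega)
    (rho : bool -> T -> R) (v : T -> R) : R :=
  \int[leb]_(x in Omega)
    ((ess_sup_eball eps mOmega v x - v x) / eps * rho false x) +
  \int[leb]_(x in Omega)
    ((v x - ess_inf_eball eps mOmega v x) / eps * rho true x).

(* Functionals are defined on representatives; linearity and the norm bound
   make them invariant under almost everywhere equality. *)
Definition Linfty_dual (Omega : set T) (mOmega : measurable Omega)
    (phi : Linfty mOmega -> R) :=
  scalar phi /\
  exists C : R, forall v : Linfty mOmega,
    `|phi v| <= C * fine ('N[lebesgue_on mOmega]_+oo[EFin \o v])%E.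

Definition subdiff_TV (eps : R) (Omega : set T) (mOmega : measurable Omega)
    (rho : bool -> T -> R) (u : Linfty mOmega) : set (Linfty mOmega -> R) :=
  [set phi | Linfty_dual phi /\
    forall v : Linfty mOmega,
      TV eps mOmega rho u + phi (v - u) <= TV eps mOmega rho v].

(* A charge on the Borel subsets of Omega is represented by a charge on the
   Borel sets of R^N that vanishes on the null sets of the restriction of the
   Lebesgue measure to Omega, in particular outside Omega. Boundedness is not
   automatic for finitely additive set functions with finite values. *)
Definition ba (Omega : set T) (mOmega : measurable Omega) :
    set (additive_charge T R) :=
  [set nu | (exists M : R, forall A : set T, measurable A ->
              (`|nu A| <= M%:E)%E) /\
            content_dominates (lebesgue_on mOmega) nu].

(* The integral against a finitely additive measure, as the continuous
   extension of the integral of simple functions. *)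
Definition ba_integral (Omega : set T) (mOmega : measurable Omega)
    (nu : set T -> \bar R) (v : T -> R) : R :=
  get [set r : R | forall s : nat -> {sfun T >-> R},
    ('N[lebesgue_on mOmega]_+oo[EFin \o (v \- s n)%R])%E
      @[n --> \oo] --> 0%E ->
    sintegral nu (s n) @[n --> \oo] --> r%:E].

Definition density (Omega : set T) (nu : set T -> \bar R) (f : T -> R) :=
  leb.-integrable Omega (EFin \o f) /\
  forall A : set T, measurable A -> A `<=` Omega ->
    (nu A = \int[leb]_(x in A) (f x)%:E)%E.

Definition marginal (P : set (T * bool) -> \bar R) (i : bool) (A : set T) :
    \bar R :=
  P (A `*` [set i]).

Definition ess_supp (Omega : set T) (f : T -> R) : set T :=
  ~` \bigcup_(U in [set U : set T | open U /\
       \forall y \ae leb, (Omega `&` U) y -> f y = 0]) U.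

Definition kernel_representative (eps : R) (Omega : set T)
    (Psi : T * T -> R) :=
  forall x, Omega x ->
    (\int[leb]_(y in Omega) (Psi (x, y))%:E = 1)%E /\
    ess_supp Omega (fun y => Psi (x, y)) `<=`
      closure (eball x eps) `&` closure Omega.

Definition transport_kernels (eps : R) (Omega : set T) : set (T * T -> R) :=
  [set Psi |
    [/\ (leb \x leb)%E.-integrable (Omega `*` Omega) (EFin \o Psi),
        (\forall z \ae (leb \x leb)%E, (Omega `*` Omega) z -> 0 <= Psi z) &
        exists Psi' : T * T -> R,
          [/\ measurable_fun (Omega `*` Omega) Psi',
              (\forall z \ae (leb \x leb)%E,
                (Omega `*` Omega) z -> Psi' z = Psi z) &
              kernel_representative eps Omega Psi']]].

Definition div_eps (eps : R) (Omega : set T) (f : T * T -> R) (y : T) : R :=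
  \int[leb]_(x in eball y eps `&` Omega) ((f (y, x) - f (x, y)) / eps).

Definition weighted_kernel (Psi : bool -> T * T -> R) (rho : bool -> T -> R) :
    T * T -> R :=
  fun z => Psi false z * rho false z.1 - Psi true z * rho true z.1.

End nonlocal_total_variation.

Record directed (D : Type) (le : D -> D -> Prop) : Prop := {
  directed_inhabited : inhabited D;
  directed_refl : forall a, le a a;
  directed_trans : forall a b c, le a b -> le b c -> le a c;
  directed_bound : forall a b, exists c, le a c /\ le b c }.

Definition tails (D : Type) (le : D -> D -> Prop) : set_system D :=
  filter_from [set: D] (fun a => [set b | le a b]).

(* Main.v *)
(** For kernels [Psi0], [Psi1] the pairing [- int v div[Psi; rho]] equals
    [int int (v y - v x) / eps * (Psi0 rho0 - Psi1 rho1)(x, y)], by Fubini and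
    the exchange of [x] and [y]. Since [Psi x] is a probability density
    supported in the [eps]-ball around [x] (spheres are null sets), this is at
    most [TV v], and kernels concentrated where [v] is within [eta] of its
    essential supremum (infimum) on that ball almost attain [TV v]. Hence [TV]
    is the support function of the convex set of pairings, and [phi] is a
    subgradient at [u] iff [phi <= TV] and [phi u = TV u]. A functional below
    [TV] is a weak-star limit of pairings: otherwise finitely many of its
    values could be separated in [R^n] from the pairings. The net is indexed by
    finite lists of test functions together with a precision. Conversely, an
    integral against a bounded finitely additive measure is linear and bounded,
    and the limit of the net stays below [TV]. *)

Require Import Defs.
From HB Require Import structures.
From mathcomp Require Import all_boot all_order all_algebra.
From mathcomp Require Import all_classical all_reals all_analysis.
From mathcomp Require Import measurable_realfun ess_sup_inf.
From mathcomp Require Import lra zify.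
Set Implicit Arguments.
Unset Strict Implicit.
Unset Printing Implicit Defensive.
Import HBSimple.
Import Order.TTheory GRing.Theory Num.Theory.
Import numFieldNormedType.Exports.
Local Open Scope classical_set_scope.
Local Open Scope ring_scope.

(** * Almost everywhere statements and Fubini's theorem *)

(** Suprema over kernels need not be attained, and the vectors of values of finitely many pairings
    need not form a closed set. Extremal statements therefore carry a margin, and the separation
    works with almost nearest points in place of a projection. Two classes of kernels serve the two
    inequalities. For the upper bound an arbitrary kernel is changed on a null set into a density on
    open balls, normalised almost everywhere. For the lower bound the constructed kernels are
    normalised at every point, so that they belong to the admissible class and stay there under
    convex combinations. The integral against a charge is a choice among the common limits along
    approximating sequences. It is always identified through one estimate: a simple function within
    [c] of [v] has its integral within a constant times [c] of the value. *)

Section almost_everywhere_restriction.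
Context d (T : measurableType d) (R : realType).

Lemma ae_mrestr (m : {measure set T -> \bar R}) (D : set T)
    (mD : measurable D) (P : T -> Prop) :
  (\forall x \ae mrestr m mD, P x) <-> (\forall x \ae m, D x -> P x).
Proof.
split=> -[A [mA A0 sA]].
  exists (A `&` D); split => //; first exact: measurableI.
  by move=> x /= /not_implyP[Dx nPx]; split => //; exact: sA.
exists (A `|` ~` D); split.
- by apply: measurableU => //; exact: measurableC.
- rewrite /mrestr setIUl setICl setU0.
  by apply: (subset_measure0 _ mA _ A0) => //; exact: measurableI.
- move=> x nPx; have [Dx|nDx] := pselect (D x); last by right.
  by left; apply: sA => /= /(_ Dx).
Qed.

End almost_everywhere_restriction.

Section integrability.
Context d (T : measurableType d) (R : realType) (m : {measure set T -> \bar R}).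
Implicit Types (D : set T) (f g w : T -> R).

Lemma ae_eq_integrable D f g : measurable D -> measurable_fun D g ->
  (\forall x \ae m, D x -> f x = g x) ->
  m.-integrable D (EFin \o f) -> m.-integrable D (EFin \o g).
Proof.
move=> mD mg fg fi; have /integrableP[mf foo] := fi.
apply/integrableP; split; first exact/measurable_EFinP.
rewrite (ae_eq_integral (fun x => `|(f x)%:E|)%E) //.
- by apply: measurableT_comp => //; exact/measurable_EFinP.
- exact: measurableT_comp.
- by apply: filterS fg => x /= fg Dx; rewrite fg.
Qed.

Lemma ae_bounded_integrable D f w M : measurable D -> measurable_fun D w ->
  (\forall x \ae m, D x -> `|w x| <= M) ->
  m.-integrable D (EFin \o f) -> m.-integrable D (EFin \o (fun x => w x * f x)).
Proof.
move=> mD mw wM fi; have /integrableP[mf _] := fi.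
apply/integrableP; split.
  by apply/measurable_EFinP/measurable_funM => //; exact/measurable_EFinP.
have /integrableP[_] := integrableZl mD M (integrable_abse fi).
apply: le_lt_trans; apply: ae_ge0_le_integral => //.
- apply: measurableT_comp => //; apply/measurable_EFinP/measurable_funM => //.
  exact/measurable_EFinP.
- apply: measurableT_comp => //; apply: measurable_funeM.
  exact: measurableT_comp.
- apply: filterS wM => x wM Dx /=; rewrite !lee_fin normrM.
  rewrite (@normrM _ M) normr_id ler_wpM2r//.
  exact: le_trans (wM Dx) (ler_norm _).
Qed.

Lemma ae_eq_Rintegral D f g : measurable D ->
  measurable_fun D f -> measurable_fun D g ->
  (\forall x \ae m, D x -> f x = g x) ->
  \int[m]_(x in D) f x = \int[m]_(x in D) g x.
Proof.
move=> mD mf mg fg; congr fine; apply: ae_eq_integral => //.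
- exact/measurable_EFinP.
- exact/measurable_EFinP.
- by apply: filterS fg => x /= fg Dx; rewrite fg.
Qed.

(** Pointwise comparison applies to [f] and [max f g], and the latter equals [g] almost
    everywhere. *)
Lemma ae_le_Rintegral D f g : measurable D ->
  m.-integrable D (EFin \o f) -> m.-integrable D (EFin \o g) ->
  (\forall x \ae m, D x -> f x <= g x) ->
  \int[m]_(x in D) f x <= \int[m]_(x in D) g x.
Proof.
move=> mD fi gi fg; pose h x := Num.max (f x) (g x).
have mf : measurable_fun D f by apply/measurable_EFinP; exact: measurable_int fi.
have mg : measurable_fun D g by apply/measurable_EFinP; exact: measurable_int gi.
have mh : measurable_fun D h by exact: measurable_maxr.
have gh : \forall x \ae m, D x -> g x = h x.
  by apply: filterS fg => x fg Dx; rewrite /h; apply/esym/max_idPr; exact: fg.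
rewrite (ae_eq_Rintegral mD mg mh gh); apply: le_Rintegral => //.
  exact: ae_eq_integrable gi.
by move=> x _; rewrite /h le_max lexx.
Qed.

Lemma integrable_restrictT D f : measurable D ->
  m.-integrable D (EFin \o f) <-> m.-integrable setT (EFin \o (f \_ D)).
Proof.
move=> mD; rewrite (integrable_mkcond (EFin \o f) mD).
suff -> : (EFin \o f) \_ D = EFin \o (f \_ D) by [].
by rewrite restrict_EFin.
Qed.

End integrability.

Section product_almost_everywhere.
Context d1 d2 (T1 : measurableType d1) (T2 : measurableType d2) (R : realType).
Variables (m1 : {sigma_finite_measure set T1 -> \bar R})
  (m2 : {sigma_finite_measure set T2 -> \bar R}).

Lemma ae_fst (P : T1 -> Prop) :
  (\forall x \ae m1, P x) -> \forall z \ae (m1 \x m2)%E, P z.1.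
Proof.
move=> [A [mA A0 sA]]; exists (A `*` setT); split.
- exact: measurableX.
- have -> : (m1 \x m2)%E (A `*` setT) = (m1 A * m2 setT)%E.
    exact: product_measure1E.
  by rewrite A0 mul0e.
- by move=> z /= /sA.
Qed.

Lemma ae_snd (P : T2 -> Prop) :
  (\forall x \ae m2, P x) -> \forall z \ae (m1 \x m2)%E, P z.2.
Proof.
move=> [A [mA A0 sA]]; exists (setT `*` A); split.
- exact: measurableX.
- have -> : (m1 \x m2)%E (setT `*` A) = (m1 setT * m2 A)%E.
    exact: product_measure1E.
  by rewrite A0 mule0.
- by move=> z /= /sA.
Qed.

Lemma ae_xsection (P : T1 * T2 -> Prop) :
  (\forall z \ae (m1 \x m2)%E, P z) ->
  \forall x \ae m1, \forall y \ae m2, P (x, y).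
Proof.
move=> [A [mA A0 sA]].
have : (\int[m1]_x `|m2 (xsection A x)| = 0)%E.
  rewrite -[RHS]A0; apply: eq_integral => x _.
  by rewrite gee0_abs// measure_ge0.
move/(@ae_eq_integral_abs _ _ _ m1 setT measurableT
  (fun x => m2 (xsection A x)) (measurable_fun_xsection m2 mA)).
apply: filterS => x /(_ I) Ax0; exists (xsection A x); split => //.
  exact: measurable_xsection.
by move=> y /= nP; rewrite /xsection/= inE; exact: sA.
Qed.

Lemma product_null (A : set (T1 * T2)) : measurable A ->
  (forall x, m2 (xsection A x) = 0%E) -> (m1 \x m2)%E A = 0%E.
Proof. by move=> mA A0; apply: integral0_eq => x _; exact: A0. Qed.

(** The product measure is defined through sections with the first variable fixed; Tonelli allows
    the other sections, which are the finite ones for spheres. *)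
Lemma product_null_ysection (A : set (T1 * T2)) : measurable A ->
  (forall y, m1 (ysection A y) = 0%E) -> (m1 \x m2)%E A = 0%E.
Proof.
move=> mA A0; rewrite -[LHS]/(\int[m1]_x (m2 \o xsection A) x)%E.
rewrite -(indic_fubini_tonelli_FE m2 mA) indic_fubini_tonelli//.
by apply: integral0_eq => y _; rewrite indic_fubini_tonelli_GE//=.
Qed.

End product_almost_everywhere.

Section real_fubini.
Context d1 d2 (T1 : measurableType d1) (T2 : measurableType d2) (R : realType).
Variables (m1 : {sigma_finite_measure set T1 -> \bar R})
  (m2 : {sigma_finite_measure set T2 -> \bar R}).
Implicit Type g : T1 * T2 -> R.

Lemma measurable_Rfubini g : (m1 \x m2)%E.-integrable setT (EFin \o g) ->
  measurable_fun setT (fun x => \int[m2]_y g (x, y)).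
Proof.
move=> gi; apply: (@measurableT_comp _ _ _ _ _ _ (@fine R)) => //.
exact: (@measurable_fubini_F _ _ _ _ _ m1 m2 (EFin \o g) gi).
Qed.

Lemma Rfubini g : (m1 \x m2)%E.-integrable setT (EFin \o g) ->
  \int[(m1 \x m2)%E]_z g z = \int[m1]_x \int[m2]_y g (x, y).
Proof.
move=> gi; rewrite /Rintegral -(integral12_prod_meas1 gi); congr fine.
apply: ae_eq_integral => //.
- exact: (measurable_fubini_F gi).
- by apply/measurable_EFinP; exact: measurable_Rfubini.
(* The inner integral is finite, hence recovered from its [fine], only for almost every [x]. *)
- apply: filterS (ae_integrable1 gi) => x xi _ /=.
  by rewrite fineK//; exact: integrable_fin_num.
Qed.

End real_fubini.

Section product_swap.
Context d (T : measurableType d) (R : realType).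
Variable m : {sigma_finite_measure set T -> \bar R}.
Implicit Type g : T * T -> R.

Lemma integrable_swap g : (m \x m)%E.-integrable setT (EFin \o g) ->
  (m \x m)%E.-integrable setT (EFin \o (fun z => g (z.2, z.1))).
Proof.
move=> gi; have mg : measurable_fun setT (EFin \o g) by exact: measurable_int gi.
have mgs : measurable_fun setT (EFin \o (fun z => g (z.2, z.1))).
  apply: (measurableT_comp mg); exact: measurable_swap.
apply/(integrable12ltyP m m mgs).
exact/(integrable21ltyP m m mg).
Qed.

Lemma Rintegral_swap g : (m \x m)%E.-integrable setT (EFin \o g) ->
  \int[(m \x m)%E]_z g (z.2, z.1) = \int[(m \x m)%E]_z g z.
Proof.
move=> gi; congr fine.
rewrite -(integral12_prod_meas1 (integrable_swap gi)).
by rewrite -(integral21_prod_meas1 gi).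
Qed.

End product_swap.

(** * Lebesgue measure of balls and spheres *)

Section euclidean_geometry.
Context (R : realType).

Lemma enormB (N : nat) (x y : 'rV[R]_N) : enorm (x - y) = enorm (y - x).
Proof.
by rewrite /enorm; congr Num.sqrt; apply: eq_bigr => j _; rewrite !mxE -sqrrN opprB.
Qed.

Lemma enorm0 (N : nat) : enorm (0 : 'rV[R]_N) = 0.
Proof. by rewrite /enorm big1 ?sqrtr0// => j _; rewrite mxE expr0n. Qed.

Lemma continuous_enormB (N : nat) (x : 'rV[R]_N) :
  continuous (fun y : 'rV[R]_N => enorm (x - y)).
Proof.
move=> y; rewrite /enorm.
apply: (@continuous_comp _ _ _
  (fun y : 'rV[R]_N => \sum_j (x - y) 0 j ^+ 2) (@Num.sqrt R)); last first.
  exact: sqrt_continuous.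
apply: (@cvg_big _ _ _ _ _ _ _ (nbhs y)); first exact: add_continuous.
move=> j _; rewrite (_ : (x - y) 0 j ^+ 2 = (x 0 j - y 0 j) ^+ 2) ?mxE//.
rewrite (_ : (fun z => (x - z) 0 j ^+ 2) = (fun z => (x 0 j - z 0 j) ^+ 2)).
  apply: (@continuous_comp _ _ _ (fun y : 'rV[R]_N => x 0 j - y 0 j)
    (fun a : R => a ^+ 2)); last exact: exprn_continuous.
  apply: (@continuousB _ _ _ (cst (x 0 j)) (fun y : 'rV[R]_N => y 0 j)).
    exact: cst_continuous.
  exact: coord_continuous.
by apply/funext => z; rewrite !mxE.
Qed.

Lemma open_eball (N : nat) (x : 'rV[R]_N) r : open (eball x r).
Proof.
have -> : eball x r = (fun y => enorm (x - y)) @^-1` `]-oo, r[%classic.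
  by apply/seteqP; split => y /=; rewrite in_itv.
move/continuousP : (@continuous_enormB N x); apply; exact: interval_open.
Qed.

Lemma closure_eball (N : nat) (x : 'rV[R]_N) r :
  closure (eball x r) `<=` [set y | enorm (x - y) <= r].
Proof.
have cB : closed [set y | enorm (x - y) <= r].
  apply: (@preimage_closed _ _ (fun y : 'rV[R]_N => enorm (x - y)) [set a | a <= r]).
    by move=> y _; exact: continuous_enormB.
  exact: closed_le.
rewrite closureE; apply: smallest_sub => // z /=; exact: ltW.
Qed.

Lemma subrVE (n : nat) (x y : 'rV[R]_n) j : (x - y) 0 j = x 0 j - y 0 j.
Proof. by rewrite !mxE. Qed.

Lemma cons_rV_head (n : nat) (a : R) (t : 'rV[R]_n) :
  cons_rV (a, t) 0 ord0 = a.
Proof. by have := cons_rVK (a, t); rewrite /uncons_rV => -[]. Qed.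

Lemma cons_rV_tail (n : nat) (a : R) (t : 'rV[R]_n) (j : 'I_n) :
  cons_rV (a, t) 0 (lift ord0 j) = t 0 j.
Proof.
have e : (uncons_rV (cons_rV (a, t))).2 = t by rewrite cons_rVK.
by rewrite -[in RHS]e /= [RHS]mxE; congr (fun_of_matrix _ _ _); exact: val_inj.
Qed.

Lemma measurable_sphere (N : nat) (x : 'rV[R]_N) (r : R) :
  measurable [set y | enorm (x - y) = r].
Proof.
have cB : closed [set y | enorm (x - y) = r].
  apply: (@preimage_closed _ _ (fun y : 'rV[R]_N => enorm (x - y)) [set a | a = r]).
    by move=> y _; exact: continuous_enormB.
  exact: closed_eq.
rewrite -[X in measurable X]setCK; apply: measurableC; apply: open_measurable_rV.
exact: closed_openC.
Qed.

Lemma lebesgue_sphere (N : nat) (x : 'rV[R]_N) (r : R) : 0 < r ->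
  lebesgue_rV R N [set y | enorm (x - y) = r] = 0%E.
Proof.
case: N x => [|n] x r0.
  suff -> : [set y | enorm (x - y) = r] = set0 by rewrite measure0.
  apply/seteqP; split => // y /=.
  by rewrite /enorm big_ord0 sqrtr0 => r00; rewrite r00 ltxx in r0.
set S := [set y | _].
rewrite -[LHS]/((lebesgue_measure \x lebesgue_rV R n)%E (@cons_rV R n @^-1` S)).
apply: product_null_ysection.
  rewrite -[X in measurable X]setTI; apply: measurable_cons_rV => //.
  exact: measurable_sphere.
move=> t; pose c := \sum_j (rsubmx (x : 'rV[R]_(1 + n)) - t) 0 j ^+ 2.
pose s := Num.sqrt (r ^+ 2 - c).
(* With the tail [t] fixed, the equation of the sphere is quadratic in the first coordinate and has
   at most two roots. *)
have sub : ysection (@cons_rV R n @^-1` S) t `<=` [set x 0 0 - s; x 0 0 + s].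
  move=> a; rewrite /ysection/= inE /S/= => xar.
  have : (x 0 0 - a) ^+ 2 = r ^+ 2 - c.
    rewrite -xar sqr_sqrtr; last by rewrite sumr_ge0// => j _; exact: sqr_ge0.
    rewrite big_ord_recl/= -addrA (_ : \sum_(i < n) _ = c).
      by rewrite subrr addr0 subrVE cons_rV_head.
    apply: eq_bigr => j _; rewrite !subrVE cons_rV_tail [rsubmx _ _ _]mxE.
    by congr ((x _ _ - _) ^+ 2); apply: val_inj.
  move=> h; have /eqP : `|x 0 0 - a| = s by rewrite /s -h sqrtr_sqr.
  rewrite eqr_norml => /andP[/orP[] /eqP xas _]; [left|right].
    by rewrite -xas subKr.
  by rewrite -[s]opprK -xas subKr.
apply: countable_lebesgue_measure0; apply: sub_countable (subset_card_le sub) _.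
exact: finite_set_countable.
Qed.

(** [ball] is taken in the maximum norm: it is a cube, and splits as a product under [cons_rV]. *)
Lemma lebesgue_rV_ball (N : nat) (x : 'rV[R]_N) (r : R) : 0 < r ->
  lebesgue_rV R N (ball x r) = ((r *+ 2) ^+ N)%:E.
Proof.
move=> r0; elim: N x => [|n ih] x.
  rewrite expr0 /= diracE mem_set//; split => // i; case => //.
rewrite -[LHS]/((lebesgue_measure \x lebesgue_rV R n)%E (@cons_rV R n @^-1` ball x r)).
pose x0 := x 0 0; pose x' := rsubmx (x : 'rV[R]_(1 + n)).
have -> : @cons_rV R n @^-1` ball x r =
    ball x0 r `*` ball x' r.
  apply/seteqP; split => [[a t] /= [_ h]|[a t] /= [ha [_ ht]]].
    split => /=; first by have := h 0 ord0; rewrite cons_rV_head.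
    split => // i j; rewrite ord1 mxE.
    have := h 0 (lift ord0 j); rewrite cons_rV_tail.
    by congr (ball (x _ _) _ _); apply: val_inj.
  split => // i j; rewrite ord1.
  have [k ->|->] := unliftP ord0 j; last by rewrite cons_rV_head.
  have := ht 0 k; rewrite mxE cons_rV_tail.
  by congr (ball (x _ _) _ _); apply: val_inj.
have -> : (lebesgue_measure \x lebesgue_rV R n)%E
    (ball x0 r `*` ball x' r) =
    (lebesgue_measure (ball x0 r) *
     lebesgue_rV R n (ball x' r))%E.
  apply: product_measure1E; first exact: measurable_ball.
  by apply: open_measurable_rV; exact: ball_open.
by rewrite ih lebesgue_measure_ball ?ltW// exprS EFinM.
Qed.

Lemma lebesgue_open_gt0 (N : nat) (U : set 'rV[R]_N) :
  open U -> U !=set0 -> (0 < lebesgue_rV R N U)%E.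
Proof.
move=> oU [x Ux]; have /nbhs_ballP[e /= e0 xeU] : nbhs x U.
  by exact: open_nbhs_nbhs.
apply: (@lt_le_trans _ _ (lebesgue_rV R N (ball x e))).
  by rewrite lebesgue_rV_ball// lte_fin exprn_gt0// mulrn_wgt0.
by apply: le_measure => //; rewrite inE; apply: open_measurable_rV => //; exact: ball_open.
Qed.

Lemma lebesgue_bounded_lty (N : nat) (A : set 'rV[R]_N) :
  measurable A -> bounded_set A -> (lebesgue_rV R N A < +oo)%E.
Proof.
move=> mA [M [_ MA]]; pose r := `|M| + 2.
have r0 : 0 < r by rewrite /r ltr_wpDl.
apply: (@le_lt_trans _ _ (lebesgue_rV R N (ball 0 r))); last first.
  by rewrite lebesgue_rV_ball// ltry.
apply: le_measure => //; rewrite ?inE//.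
  by apply: open_measurable_rV => //; exact: ball_open.
move=> x Ax; rewrite -ball_normE/= sub0r normrN.
apply: (@le_lt_trans _ _ (`|M| + 1)); last by rewrite /r ltrD2l ltr1n.
by apply: MA => //; rewrite (le_lt_trans (ler_norm _))// ltrDl.
Qed.

End euclidean_geometry.

(** * Essential suprema on balls *)

Section essential_supremum_on_balls.
Context (R : realType) (N : nat) (eps : R) (eps_gt0 : 0 < eps)
  (Omega : set 'rV[R]_N) (mOmega : measurable Omega) (oOmega : open Omega).
Local Notation T := 'rV[R]_N.
Local Notation leb := (lebesgue_rV R N).
Local Notation S := (ess_sup_eball eps mOmega).

(** The divergence and the essential suprema use open balls, so all integrals are brought to this
    set; the kernels are supported in closed balls, and the difference lies on spheres. *)
Definition close_pairs : set (T * T) :=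
  [set z | [/\ Omega z.1, Omega z.2 & enorm (z.1 - z.2) < eps]].

Definition ae_bounded (v : T -> R) :=
  exists M, \forall x \ae leb, Omega x -> `|v x| <= M.

Lemma measurable_enormB :
  measurable_fun [set: T * T] (fun z : T * T => enorm (z.1 - z.2)).
Proof.
apply: (measurableT_comp (f := @Num.sqrt R)).
  by apply: continuous_measurable_fun; exact: sqrt_continuous.
apply: measurable_sum => j; apply: measurable_funX.
under eq_fun do rewrite !mxE.
apply: measurable_funB.
  exact: (measurableT_comp (measurable_coord j) (@measurable_fst _ _ _ _)).
exact: (measurableT_comp (measurable_coord j) (@measurable_snd _ _ _ _)).
Qed.

Lemma measurable_close_pairs : measurable close_pairs.
Proof.
rewrite (_ : close_pairs = (Omega `*` Omega) `&`
  ([set: T * T] `&` (fun z : T * T => enorm (z.1 - z.2)) @^-1` `]-oo, eps[%classic)).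
  apply: measurableI; first exact: measurableX.
  exact: measurable_enormB.
apply/seteqP; split=> z /=; rewrite in_itv/=; first by case.
by case=> -[? ?] [].
Qed.

Lemma close_pairsC z : close_pairs z -> close_pairs (z.2, z.1).
Proof. by case=> ? ? ?; split => //=; rewrite enormB. Qed.

Lemma ae_eball (P : T -> Prop) x :
  (\forall y \ae mrestr (lebesgue_on mOmega) (measurable_eball x eps), P y) <->
  (\forall y \ae leb, Omega y -> enorm (x - y) < eps -> P y).
Proof.
split.
  by move=> /ae_mrestr /ae_mrestr; apply: filterS => y h Oy xy; exact: h.
by move=> h; apply/ae_mrestr/ae_mrestr; apply: filterS h => y h Oy xy; exact: h.
Qed.

Lemma lebesgue_eball_gt0 x : Omega x ->
  (0 < mrestr (lebesgue_on mOmega) (measurable_eball x eps) [set: T])%E.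
Proof.
move=> Ox; rewrite /mrestr /lebesgue_on /mrestr setTI; apply: lebesgue_open_gt0.
  by apply: openI => //; exact: open_eball.
by exists x; split => //=; rewrite /eball/= subrr enorm0.
Qed.

Section bounded_function.
Variables (v : T -> R) (mv : measurable_fun setT v) (bv : ae_bounded v).

(** [fine] loses nothing here: the bound on [v] excludes [+oo], and [-oo] is excluded because the
    ball meets the open set [Omega] in a set of positive measure. *)
Lemma ess_sup_eballE x : Omega x ->
  ess_sup (mrestr (lebesgue_on mOmega) (measurable_eball x eps)) (EFin \o v)
    = (S v x)%:E.
Proof.
move=> Ox; rewrite /ess_sup_eball fineK//; have [M vM] := bv.
rewrite fin_numE; apply/andP; split.
  apply/eqP => e.
  have : ((- M)%:E <= -oo :> \bar R)%E.
    rewrite -e; apply: ess_sup_gee; first exact: lebesgue_eball_gt0.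
    apply/ae_eball; apply: filterS vM => y vM Oy _ /=.
    by rewrite lee_fin; have := vM Oy; rewrite ler_norml => /andP[].
  by [].
have : (ess_sup (mrestr (lebesgue_on mOmega) (measurable_eball x eps)) (EFin \o v) <= M%:E)%E.
  apply/ess_supP; apply/ae_eball; apply: filterS vM => y vM Oy _ /=.
  by rewrite lee_fin (le_trans (ler_norm _))// vM.
by case: ess_sup.
Qed.

Lemma ess_sup_eball_le x s : Omega x ->
  S v x <= s <-> (\forall y \ae leb, Omega y -> enorm (x - y) < eps -> v y <= s).
Proof.
move=> Ox; rewrite -lee_fin -ess_sup_eballE//; split.
  by move=> /ess_supP/ae_eball; apply: filterS => y h Oy xy; rewrite -lee_fin; exact: h.
by move=> h; apply/ess_supP/ae_eball; apply: filterS h => y h Oy xy; rewrite lee_fin; exact: h.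
Qed.

Lemma ess_sup_eball_ae x : Omega x ->
  \forall y \ae leb, Omega y -> enorm (x - y) < eps -> v y <= S v x.
Proof. by move=> Ox; apply/ess_sup_eball_le. Qed.

Lemma ess_sup_eball_bounded M : (\forall x \ae leb, Omega x -> `|v x| <= M) ->
  forall x, Omega x -> `|S v x| <= M.
Proof.
move=> vM x Ox; rewrite ler_norml; apply/andP; split.
  rewrite -lee_fin -ess_sup_eballE//.
  apply: ess_sup_gee; first exact: lebesgue_eball_gt0.
  apply/ae_eball; apply: filterS vM => y vM Oy _ /=.
  by rewrite lee_fin; have := vM Oy; rewrite ler_norml => /andP[].
apply/ess_sup_eball_le => //; apply: filterS vM => y vM Oy _.
by rewrite (le_trans (ler_norm _))// vM.
Qed.

Lemma measurable_superlevel (s : T -> R) : measurable_fun Omega s ->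
  measurable [set z | close_pairs z /\ s z.1 < v z.2].
Proof.
move=> ms; have ms' : measurable_fun close_pairs (fun z : T * T => s z.1).
  apply: (@measurable_comp _ _ _ _ _ _ Omega) => //.
    by move=> _ [z [Oz _ _]] <-.
  exact: measurable_funTS.
rewrite (_ : [set z | _] = close_pairs `&`
    (fun z : T * T => v z.2 - s z.1) @^-1` `]0, +oo[%classic).
  apply: measurable_funB => //; last exact: measurable_close_pairs.
  by apply: measurable_funTS; exact: (measurableT_comp mv).
by apply/seteqP; split=> z /=; rewrite in_itv/= andbT subr_gt0.
Qed.

(** Were this set null, [s] would be an essential upper bound below the essential supremum.
    Positivity makes the uniform density on such a set available. *)
Lemma lebesgue_superlevel_gt0 x s : Omega x -> s < S v x ->
  (0 < leb [set y | close_pairs (x, y) /\ (s < v y)%R])%E.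
Proof.
move=> Ox sS; rewrite lt0e measure_ge0 andbT; apply/eqP => A0.
suff : S v x <= s by rewrite leNgt sS.
apply/ess_sup_eball_le => //; exists [set y | close_pairs (x, y) /\ s < v y]; split => //.
  have := @measurable_xsection _ _ _ _ _ x (measurable_superlevel (measurable_cst s)).
  by congr measurable; apply/seteqP; split => y; rewrite /xsection/= inE.
move=> y /= /not_implyP[Oy /not_implyP[xy /negP]]; rewrite -ltNge => sv.
by split.
Qed.

(** [S v x > t] exactly when the section at [x] of the close pairs with [v y > t] has positive
    measure, and the measure of a section depends measurably on the point. *)
Lemma measurable_ess_sup_eball : measurable_fun Omega (S v).
Proof.
apply: (measurability _ (RGenOInfty.measurableE R)) => // _ [_ [t ->] <-].
pose A := [set z : T * T | close_pairs z /\ t < v z.2].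
have mA : measurable A by exact: (measurable_superlevel (measurable_cst t)).
rewrite (_ : _ `&` _ = Omega `&` (fun x => leb (xsection A x)) @^-1` `]0%E, +oo%E]%classic).
  have := @measurable_fun_xsection _ _ _ _ _ leb _ mA.
  move=> /(_ measurableT `]0%E, +oo%E]%classic (emeasurable_itv _)).
  by rewrite setTI => /(measurableI _ _ mOmega).
have AE x : xsection A x = [set y | close_pairs (x, y) /\ t < v y].
  by apply/seteqP; split => y; rewrite /xsection/= inE.
apply/seteqP; split=> x /= [Ox]; rewrite !in_itv/= leey !andbT AE => h; split => //.
  exact: lebesgue_superlevel_gt0.
rewrite ltNge; apply/negP => /(ess_sup_eball_le _ Ox)[B [mB B0 sB]].
move: h; apply/negP; rewrite -leNgt -B0; apply: le_measure => //; rewrite ?inE//.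
  by rewrite -AE; exact: measurable_xsection.
move=> y [[_ /= Oy xy] ty]; apply: sB => /= /(_ Oy xy).
by rewrite leNgt ty.
Qed.

End bounded_function.

End essential_supremum_on_balls.

(** * The nonlocal divergence and transport kernels *)

Section pairing_with_divergence.
Context (R : realType) (N : nat) (eps : R)
  (Omega : set 'rV[R]_N) (mOmega : measurable Omega).
Local Notation T := 'rV[R]_N.
Local Notation leb := (lebesgue_rV R N).
Local Notation leb2 := (leb \x leb)%E.
Local Notation D := (close_pairs eps Omega).

Lemma close_pairs_bounded (v : T -> R) : ae_bounded Omega v ->
  exists M, \forall z \ae leb2, D z -> `|(v z.2 - v z.1) / eps| <= M.
Proof.
move=> [M vM]; exists ((M + M) * `|eps^-1| ).
have h1 := ae_fst leb vM; have h2 := ae_snd leb vM.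
near=> z => -[x1 x2 _].
have v1 : Omega z.1 -> `|v z.1| <= M by near: z.
have v2 : Omega z.2 -> `|v z.2| <= M by near: z.
rewrite normrM ler_wpM2r//; apply: le_trans (ler_normB _ _) _.
by apply: lerD; [exact: v2|exact: v1].
Unshelve. all: by end_near. Qed.

Lemma measurable_difference_quotient (v : T -> R) : measurable_fun setT v ->
  measurable_fun D (fun z : T * T => (v z.2 - v z.1) / eps).
Proof.
move=> mv; apply: measurable_funTS; apply: measurable_funM => //.
by apply: measurable_funB; exact: (measurableT_comp mv).
Qed.

Lemma integrable_difference_quotient (v : T -> R) (f : T * T -> R) :
  measurable_fun setT v -> ae_bounded Omega v ->
  leb2.-integrable D (EFin \o f) ->
  leb2.-integrable D (EFin \o (fun z => (v z.2 - v z.1) / eps * f z)).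
Proof.
move=> mv /close_pairs_bounded[M vM]; apply: ae_bounded_integrable vM.
  exact: measurable_close_pairs.
exact: measurable_difference_quotient.
Qed.

(* The divergence is antisymmetrised in its kernel, so exchanging the two
   variables in one of the two halves moves the difference onto [v]. *)
Lemma pairing_divergence (v : T -> R) (f : T * T -> R) :
  measurable_fun setT v -> ae_bounded Omega v ->
  leb2.-integrable D (EFin \o f) ->
  - (\int[leb]_(x in Omega) (v x * div_eps eps Omega f x)) =
  \int[leb2]_(z in D) ((v z.2 - v z.1) / eps * f z).
Proof.
move=> mv bv fi; have mD : measurable D := measurable_close_pairs eps mOmega.
(* Both [f] and [v] are extended by zero, because Fubini and the exchange of variables are applied
   on the whole product. *)
pose g := f \_ D; have gi : leb2.-integrable setT (EFin \o g).
  exact: (iffLR (integrable_restrictT _ f mD) fi).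
have gsi := integrable_swap gi.
pose v' := (v \_ Omega).
have mv' : measurable_fun setT v'.
  by apply: (iffLR (measurable_restrictT v mOmega)); exact: measurable_funTS.
have [M vM] : exists M, \forall x \ae leb, `|v' x| <= M.
  have [M vM] := bv; exists `|M|; apply: filterS vM => x vM.
  rewrite /v' patchE; case: ifPn; last by rewrite normr0.
  by rewrite inE => /vM /le_trans; apply; exact: ler_norm.
have bfst (w : T * T -> R) : leb2.-integrable setT (EFin \o w) ->
    leb2.-integrable setT (EFin \o (fun z => v' z.1 * w z)).
  apply: (@ae_bounded_integrable _ _ _ _ _ _ _ M) => //.
    exact: (measurableT_comp mv').
  by apply: filterS (ae_fst leb vM) => z h _.
have bsnd (w : T * T -> R) : leb2.-integrable setT (EFin \o w) ->
    leb2.-integrable setT (EFin \o (fun z => v' z.2 * w z)).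
  apply: (@ae_bounded_integrable _ _ _ _ _ _ _ M) => //.
    exact: (measurableT_comp mv').
  by apply: filterS (ae_snd leb vM) => z h _.
have Zl c (w : T * T -> R) : leb2.-integrable setT (EFin \o w) ->
    leb2.-integrable setT (EFin \o (fun z => c * w z)).
  by move=> wi; exact: (integrableZl measurableT c wi).
have Bl (w1 w2 : T * T -> R) : leb2.-integrable setT (EFin \o w1) ->
    leb2.-integrable setT (EFin \o w2) ->
    leb2.-integrable setT (EFin \o (fun z => w1 z - w2 z)).
  by move=> w1i w2i; exact: (integrableB measurableT w1i w2i).
pose h z := eps^-1 * (g z - g (z.2, z.1)).
have hi : leb2.-integrable setT (EFin \o h) by apply: Zl; exact: Bl.
have -> : \int[leb]_(x in Omega) (v x * div_eps eps Omega f x) =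
    \int[leb2]_z (v' z.1 * h z).
  rewrite Rfubini; last exact: bfst.
  rewrite Rintegral_mkcond (_ : _ \_ _ = fun x => v' x * \int[leb]_y h (x, y)).
    apply: ae_eq_Rintegral => //.
    - by apply: measurable_funM => //; exact: (measurable_Rfubini hi).
    - exact: (measurable_Rfubini (bfst _ hi)).
    - apply: filterS (ae_integrable1 hi) => x xi _.
      by rewrite -RintegralZl.
  apply/funext => x; rewrite /v' !patchE; case: ifPn; last by rewrite mul0r.
  rewrite inE => Ox; congr (_ * _); rewrite /div_eps Rintegral_mkcond.
  congr (Rintegral _ _ _); apply/funext => y; rewrite /h /g !patchE.
  have DE : (D (x, y)) = (eball x eps `&` Omega) y.
    by apply/propext; split=> [[/= ? ? ?]|[/= ? ?]]; split.
  case: ifPn => [|nD].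
    rewrite inE -DE => Dz; rewrite !mem_set//=; last exact: (close_pairsC Dz).
    by rewrite mulrC.
  rewrite !memNset ?subrr ?mulr0//=.
    by move/close_pairsC => /=; rewrite DE => /mem_set; rewrite (negPf nD).
  by rewrite DE => /mem_set; rewrite (negPf nD).
pose A := \int[leb2]_z (eps^-1 * (v' z.1 * g z)).
pose B := \int[leb2]_z (eps^-1 * (v' z.2 * g z)).
have -> : \int[leb2]_z (v' z.1 * h z) = A - B.
  have swapB : B = \int[leb2]_z (eps^-1 * (v' z.1 * g (z.2, z.1))).
    have G : leb2.-integrable setT (EFin \o (fun z => eps^-1 * (v' z.2 * g z))).
      by apply: Zl; exact: bsnd.
    exact/esym/(Rintegral_swap G).
  rewrite swapB -RintegralB//; last 2 first.
    by apply: Zl; exact: bfst.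
    by apply: Zl; exact: bfst.
  apply: eq_Rintegral => z _; rewrite /h mulrCA -mulrBr.
  by congr (_ * _); rewrite mulrBr.
rewrite opprB -RintegralB//; last 2 first.
  by apply: Zl; exact: bsnd.
  by apply: Zl; exact: bfst.
rewrite [RHS]Rintegral_mkcond; congr (Rintegral _ _ _); apply/funext => z.
rewrite -mulrBr -mulrBl /g !patchE; case: ifPn; last by rewrite !mulr0.
rewrite inE => -[x1 x2 _]; rewrite /v' !patchE !mem_set//.
by rewrite mulrA (mulrC eps^-1).
Qed.

End pairing_with_divergence.

Section transport_densities.
Context (R : realType) (N : nat) (eps : R)
  (Omega : set 'rV[R]_N) (mOmega : measurable Omega).
Local Notation T := 'rV[R]_N.
Local Notation leb := (lebesgue_rV R N).
Local Notation leb2 := (leb \x leb)%E.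
Local Notation D := (close_pairs eps Omega).
Local Notation S := (ess_sup_eball eps mOmega).

(** The normal form of an admissible kernel up to null sets. Normalisation is kept only for almost
    every [x], since the change on a null set of pairs may spoil exceptional sections. *)
Definition transport_density (k : T * T -> R) :=
  [/\ measurable_fun setT k, (forall z, 0 <= k z), (forall z, ~ D z -> k z = 0) &
      \forall x \ae leb, Omega x -> (\int[leb]_y (k (x, y))%:E = 1)%E].

(** Normalisation at every point of [Omega] lets such a [k] be its own representative in
    [transport_kernels]. *)
Definition exact_transport_density (k : T * T -> R) :=
  [/\ measurable_fun setT k, (forall z, 0 <= k z), (forall z, ~ D z -> k z = 0) &
      forall x, Omega x -> (\int[leb]_y (k (x, y))%:E = 1)%E].

Lemma exact_transport_densityW k :
  exact_transport_density k -> transport_density k.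
Proof. by case=> ? ? ? h; split => //; apply: aeW => x; exact: h. Qed.

(** Integrating [k] in its second variable gives 1, so by Tonelli the weight [h] alone decides
    integrability and no bound on [k] is required. *)
Lemma density_marginal (k : T * T -> R) (h : T -> R) : transport_density k ->
  leb.-integrable Omega (EFin \o h) ->
  leb2.-integrable D (EFin \o (fun z => h z.1 * k z)) /\
  \int[leb2]_(z in D) (h z.1 * k z) = \int[leb]_(x in Omega) h x.
Proof.
move=> [mk k0 kD k1] hi; have mD : measurable D := measurable_close_pairs eps mOmega.
pose H := h \_ Omega.
have Hi : leb.-integrable setT (EFin \o H) := iffLR (integrable_restrictT _ h mOmega) hi.
have mH : measurable_fun setT H by apply/measurable_EFinP; exact: measurable_int Hi.
have mkx x : measurable_fun setT (fun y => (k (x, y))%:E).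
  by apply/measurable_EFinP; exact: (measurableT_comp mk).
pose w z := H z.1 * k z.
have mw : measurable_fun setT (EFin \o w).
  by apply/measurable_EFinP; apply: measurable_funM => //; exact: (measurableT_comp mH).
have wE : (fun z => h z.1 * k z) \_ D = w.
  apply/funext => z; rewrite /w patchE; case: ifPn => [|nD].
    by rewrite inE => -[x1 _ _]; rewrite /H patchE mem_set.
  by rewrite kD ?mulr0// => /mem_set; rewrite (negPf nD).
have H0 x : ~ Omega x -> H x = 0 by move=> nx; rewrite /H patchE memNset.
have wi : leb2.-integrable setT (EFin \o w).
  apply/(integrable12ltyP leb leb mw).
  have /integrableP[_] := Hi; apply: le_lt_trans.
  rewrite le_eqVlt; apply/orP; left; apply/eqP; apply: ae_eq_integral => //.
  - apply: (measurable_fun_fubini_tonelli_F (fun z => `|(w z)%:E|%E)) => //.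
    exact: measurableT_comp mw.
  - by apply: measurableT_comp => //; apply/measurable_EFinP.
  - apply: filterS k1 => x k1 _ /=; have [Ox|/H0 Hx0] := pselect (Omega x).
      transitivity (\int[leb]_y (`|H x|%:E * (k (x, y))%:E))%E.
        by apply: eq_integral => y _; rewrite /w/= normrM (ger0_norm (k0 _)) EFinM.
      by rewrite ge0_integralZl_EFin ?k1 ?mule1// => y _; rewrite lee_fin.
    rewrite Hx0 normr0; apply: integral0_eq => y _.
    by rewrite /w/= Hx0 mul0r normr0.
split; first by apply: (iffRL (integrable_restrictT _ _ mD)); rewrite wE.
rewrite [LHS]Rintegral_mkcond wE Rfubini// [RHS]Rintegral_mkcond -/H.
apply: ae_eq_Rintegral => //; first exact: (measurable_Rfubini wi).
apply: filterS k1 => x k1 _ /=; have [Ox|/H0 Hx0] := pselect (Omega x).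
  rewrite /w /= RintegralZl//.
    by rewrite /Rintegral k1//= mulr1.
  apply/integrableP; split; first exact: mkx.
  rewrite (_ : integral _ _ _ = 1%E) ?ltry// -(k1 Ox).
  by apply: eq_integral => y _; rewrite gee0_abs// lee_fin.
by rewrite Hx0 /Rintegral integral0_eq// => y _; rewrite /w/= Hx0 mul0r.
Qed.

(** The rate at which [v] grows, on average, when the mass [r] is moved by [k]; the decrease of [v]
    is the gain of [\- v]. *)
Definition transport_gain (v r : T -> R) (k : T * T -> R) : R :=
  \int[leb2]_(z in D) ((v z.2 - v z.1) / eps * (r z.1 * k z)).

Definition half_TV (v r : T -> R) : R :=
  \int[leb]_(x in Omega) ((S v x - v x) / eps * r x).

Section bounds.
Hypothesis (eps_gt0 : 0 < eps) (oOmega : open Omega).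
Variables (v r : T -> R) (mv : measurable_fun setT v) (bv : ae_bounded Omega v)
  (ri : leb.-integrable Omega (EFin \o r)) (r0 : forall x, Omega x -> 0 <= r x).

Lemma integrable_gain k : transport_density k ->
  leb2.-integrable D
    (EFin \o (fun z => (v z.2 - v z.1) / eps * (r z.1 * k z))).
Proof.
move=> dk; apply: integrable_difference_quotient => //.
by have [] := density_marginal dk ri.
Qed.

Lemma integrable_half_TV c :
  leb.-integrable Omega (EFin \o (fun x => (S v x - c - v x) / eps * r x)).
Proof.
have [M vM] := bv.
apply: (@ae_bounded_integrable _ _ _ _ _ _ _ ((M + `|c| + M) / eps)) => //.
  apply: measurable_funM => //; apply: measurable_funB.
    by apply: measurable_funB => //; exact: measurable_ess_sup_eball.
  exact: measurable_funTS.
apply: filterS (vM) => x vxM Ox; rewrite normrM (gtr0_norm (x := eps^-1)) ?invr_gt0//.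
rewrite ler_pM2r ?invr_gt0//; apply: (le_trans (ler_normB _ _)).
apply: lerD; last exact: vxM.
apply: (le_trans (ler_normB _ _)); rewrite lerD2r.
exact: (ess_sup_eball_bounded eps_gt0 mOmega oOmega bv vM).
Qed.

(** By [density_marginal] the right-hand side is also an integral over close pairs against [k]. The
    integrands compare wherever [v y <= S v x], and the exceptional set is measurable with null
    sections. *)
Lemma gain_le k : transport_density k -> transport_gain v r k <= half_TV v r.
Proof.
move=> dk; have mD : measurable D := measurable_close_pairs eps mOmega.
have := integrable_half_TV 0.
rewrite (_ : (fun x => (S v x - 0 - v x) / eps * r x) =
  (fun x => (S v x - v x) / eps * r x)); last by apply/funext=> x; rewrite subr0.
move=> Pi.
have [mi me] := density_marginal dk Pi.
rewrite /half_TV -me; apply: ae_le_Rintegral => //; first exact: integrable_gain.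
have [mk k0 kD k1] := dk.
exists [set z : T * T | D z /\ S v z.1 < v z.2]; split.
- exact: (measurable_superlevel eps mOmega mv (measurable_ess_sup_eball eps_gt0 mOmega oOmega mv bv)).
- apply: product_null.
    exact: (measurable_superlevel eps mOmega mv (measurable_ess_sup_eball eps_gt0 mOmega oOmega mv bv)).
  move=> x; rewrite (_ : xsection _ x = [set y | D (x, y) /\ (S v x < v y)%R]); last first.
    by apply/seteqP; split => y; rewrite /xsection/= inE.
  have [Ox|nOx] := pselect (Omega x); last first.
    rewrite (_ : [set y | _] = set0) ?measure0//.
    by apply/seteqP; split => // y /= [[]].
  have [B [mB B0 sB]] := ess_sup_eball_ae eps_gt0 mOmega oOmega bv Ox.
  apply: (subset_measure0 _ mB _ B0) => //.
    have := @measurable_xsection _ _ _ _ _ x (measurable_superlevel eps mOmega mv (measurable_cst (S v x))).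
    by congr measurable; apply/seteqP; split => y; rewrite /xsection/= inE.
  move=> y [[_ /= Oy xy] Sv]; apply: sB => /= /(_ Oy xy).
  by rewrite leNgt Sv.
- move=> z /= /not_implyP[Dz]; move=> /negP; rewrite -ltNge => h; split => //.
  rewrite ltNge; apply/negP => Sv; move: h; apply/negP; rewrite -leNgt.
  rewrite mulrA; apply: ler_wpM2r => //; apply: ler_wpM2r; first by case: Dz => /r0.
  by apply: ler_wpM2r; [rewrite invr_ge0 ltW|rewrite lerD2r].
Qed.

Lemma gain_near_sup (Omegay : (leb Omega < +oo)%E) eta : 0 < eta ->
  exists2 k, exact_transport_density k & half_TV v r - eta <= transport_gain v r k.
Proof.
move=> eta0; have mD : measurable D := measurable_close_pairs eps mOmega.
pose I := \int[leb]_(x in Omega) r x.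
have I0 : 0 <= I by exact: Rintegral_ge0.
(* Falling short of the supremum by [c] costs [c / eps * I], which is at most [eta]; the added 1
   covers [I = 0]. *)
pose c := eta * eps / (I + 1).
have c0 : 0 < c by rewrite divr_gt0 ?mulr_gt0// ltr_wpDl.
have mS : measurable_fun Omega (S v) by exact: measurable_ess_sup_eball.
pose A := [set z : T * T | D z /\ S v z.1 - c < v z.2].
have mA : measurable A.
  by apply: (measurable_superlevel eps mOmega mv (s := fun x => S v x - c)); exact: measurable_funB.
pose a x := leb (xsection A x).
have ma : measurable_fun setT a by exact: measurable_fun_xsection.
have AE x : xsection A x = [set y | D (x, y) /\ S v x - c < v y].
  by apply/seteqP; split => y; rewrite /xsection/= inE.
have a0 x : Omega x -> (0 < a x)%E.
  move=> Ox; rewrite /a AE; apply: lebesgue_superlevel_gt0 => //.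
  by rewrite ltrBlDr ltrDl.
have ay x : (a x < +oo)%E.
  apply: le_lt_trans Omegay; apply: le_measure; rewrite ?inE//.
    exact: measurable_xsection.
  by rewrite AE => y [[]].
(* For [x] in [Omega] this is the uniform density on the part of the ball where [v] exceeds
   [S v x - c], a set of positive measure, and of finite measure because [Omega] has finite
   measure. *)
pose k z := (fine (a z.1))^-1 * \1_A z.
have kD z : ~ D z -> k z = 0.
  by move=> nD; rewrite /k indicE memNset ?mulr0// => -[].
have ek : exact_transport_density k.
  split=> //.
  - apply: (@measurable_funM _ _ _ _ (fun z : T * T => (fine (a z.1))^-1) \1_A); last first.
      exact: measurable_indic.
    (* Measurability of the inverse is that of the power -1; the two agree on nonnegative reals,
       both being 0 at 0. *)
    rewrite (_ : (fun z => _) = (fun z : T * T => fine (a z.1) `^ (-1))).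
      apply: (measurableT_comp (measurable_powR (-1))).
      apply: (measurableT_comp (f := @fine R)) => //.
      exact: (measurableT_comp ma).
    by apply/funext => z; rewrite powR_inv1// fine_ge0// measure_ge0.
  - by move=> z; rewrite mulr_ge0// invr_ge0 fine_ge0// measure_ge0.
  - move=> x Ox; under eq_integral => y _ do rewrite /k/= EFinM.
    have mAx : measurable_fun setT (fun y => (\1_A (x, y) : R)%:E).
      apply/measurable_EFinP.
      by apply: (measurableT_comp (f := \1_A : T * T -> R)).
    have ax0 : 0 <= (fine (a x))^-1 by rewrite invr_ge0 fine_ge0// measure_ge0.
    rewrite ge0_integralZl_EFin//.
    have -> : (\int[leb]_y (\1_A (x, y))%:E = a x)%E.
      exact: (congr1 (@^~ x) (indic_fubini_tonelli_FE leb mA)).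
    rewrite -[X in (_ * X)%E]fineK ?ge0_fin_numE// -EFinM mulVf//.
    by rewrite gt_eqF// fine_gt0// a0//= ay.
exists k => //; have dk := exact_transport_densityW ek.
have Pi := integrable_half_TV c.
have [mi me] := density_marginal dk Pi.
apply: (@le_trans _ _ (\int[leb2]_(z in D) ((S v z.1 - c - v z.1) / eps * r z.1 * k z))).
  rewrite me; have Pi0 := integrable_half_TV 0.
  rewrite (_ : (fun x => (S v x - 0 - v x) / eps * r x) =
    (fun x => (S v x - v x) / eps * r x)) in Pi0;
    last by apply/funext=> x; rewrite subr0.
  have -> : \int[leb]_(x in Omega) ((S v x - c - v x) / eps * r x) =
      half_TV v r - c / eps * I.
    rewrite /I -RintegralZl// /half_TV -RintegralB//; last first.
      exact: (integrableZl mOmega _ ri).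
    apply: eq_Rintegral => x _; rewrite -mulrBl -mulrBl; congr (_ / _ * _).
    by rewrite addrAC.
  rewrite lerD2l lerN2 /c [eta * eps / _]mulrAC mulfK ?gt_eqF// mulrAC ler_pdivrMr ?ltr_wpDl//.
  by rewrite ler_pM2l// lerDl.
apply: le_Rintegral => //; first exact: integrable_gain.
move=> z Dz; rewrite /k indicE; case: (boolP (z \in A)) => [|_]; last by rewrite !mulr0.
rewrite inE => -[_ Sv]; rewrite [leRHS]mulrA; apply: ler_wpM2r.
  by rewrite mulr1 invr_ge0 fine_ge0// measure_ge0.
apply: ler_wpM2r; first by case: Dz => /r0.
by apply: ler_wpM2r; [rewrite invr_ge0 ltW|rewrite lerD2r ltW].
Qed.

End bounds.

Lemma exact_transport_kernel k : (leb Omega < +oo)%E ->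
  exact_transport_density k -> transport_kernels eps Omega k.
Proof.
move=> Omegay ek; have [mk k0 kD k1] := ek.
have mD : measurable D := measurable_close_pairs eps mOmega.
have mOO : measurable (Omega `*` Omega) by exact: measurableX.
have ki : leb2.-integrable setT (EFin \o k).
  (* The weight 1 is integrable because [Omega] has finite measure, and [density_marginal] transfers
     this to [k]. *)
  have oi : leb.-integrable Omega (EFin \o cst 1).
    apply/integrableP; split; first exact/measurable_EFinP.
    by under eq_integral do rewrite /= normr1; rewrite integral_cst// mul1e.
  have [ki _] := density_marginal (exact_transport_densityW ek) oi.
  have := iffLR (integrable_restrictT _ _ mD) ki; congr (integrable _ _ (EFin \o _)).
  apply/funext => z; rewrite patchE mul1r; case: ifPn => // nD.
  by rewrite kD// => /mem_set; rewrite (negPf nD).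
split; [exact: (integrableS _ _ _ ki)|by apply: aeW|].
exists k; split; [exact: measurable_funTS|exact: aeW|move=> x Ox; split].
  rewrite -(k1 _ Ox) integral_mkcond; apply: eq_integral => y _.
  rewrite patchE; case: ifPn => // nOy; rewrite kD// => -[_ /mem_set].
  by rewrite (negPf nOy).
move=> y ny; split; apply: contrapT => nB; apply: ny.
  exists (~` closure (eball x eps)); last exact: nB.
  split; first by apply: closed_openC; exact: closed_closure.
  apply: aeW => t [_ nt]; apply: kD => -[_ _ /= xt]; apply: nt.
  exact: subset_closure.
exists (~` closure Omega); last exact: nB.
split; first by apply: closed_openC; exact: closed_closure.
by apply: aeW => t [Ot []]; exact: subset_closure.
Qed.

End transport_densities.

Section general_kernels.
Context (R : realType) (N : nat) (eps : R) (eps_gt0 : 0 < eps)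
  (Omega : set 'rV[R]_N) (mOmega : measurable Omega).
Local Notation T := 'rV[R]_N.
Local Notation leb := (lebesgue_rV R N).
Local Notation leb2 := (leb \x leb)%E.
Local Notation D := (close_pairs eps Omega).

(* Lindelof: countably many rational boxes cover the complement of the
   essential support. *)
Lemma ess_supp_ae (f : T -> R) :
  \forall y \ae leb, Omega y -> ~ ess_supp Omega f y -> f y = 0.
Proof.
pose box (c : 'rV[rat]_N * nat) : set T :=
  [set x : T | forall j, `|x 0 j - ratr (c.1 0 j)| < c.2.+1%:R^-1].
pose G := [set U : set T | open U /\
  \forall y \ae leb, (Omega `&` U) y -> f y = 0].
pose P c y := (exists2 U, G U & box c `<=` U) -> Omega y -> box c y -> f y = 0.
have aeP c : \forall y \ae leb, P c y.
  have [[U [oU fU] cU]|nU] := pselect (exists2 U, G U & box c `<=` U).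
    by apply: filterS fU => y fy _ Oy cy; apply: fy; split => //; exact: cU.
  by apply: aeW => y /nU.
have : \forall y \ae leb, forall n : nat,
    if @unpickle ('rV[rat]_N * nat)%type n is Some c then P c y else True.
  by apply: ae_foralln => n; case: unpickle => [c|]; [exact: aeP|exact: aeW].
apply: filterS => y Py Oy /contrapT[U [oU fU] Uy].
move: (Uy); rewrite (open_rational_balls oU) => -[c cU cy].
have := Py (pickle c); rewrite pickleK; apply => //.
by exists U.
Qed.

Lemma ae_distance_neq (x : T) : \forall y \ae leb, enorm (x - y) != eps.
Proof.
exists [set y | enorm (x - y) = eps]; split.
- exact: measurable_sphere.
- exact: lebesgue_sphere.
- by move=> y /= /negP; rewrite negbK => /eqP.
Qed.

(** [k] is the positive part of the representative, cut off outside the open balls. The cut loses no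
    mass: a removed [y] lies on the sphere around [x], which is null, or outside the essential
    support, where the representative vanishes almost everywhere. *)
Lemma transport_kernel_density (Psi : T * T -> R) :
  transport_kernels eps Omega Psi ->
  exists2 k, transport_density eps Omega k &
    \forall z \ae leb2, D z -> Psi z = k z.
Proof.
move=> [_ Psi0 [Psi' [mPsi' PsiE rep]]].
have mD : measurable D := measurable_close_pairs eps mOmega.
have mOO : measurable (Omega `*` Omega) by exact: measurableX.
have DOO : D `<=` Omega `*` Omega by move=> z [].
have Psi'0 : \forall z \ae leb2, (Omega `*` Omega) z -> 0 <= Psi' z.
  near=> z => Oz.
  have -> : Psi' z = Psi z by move: Oz; near: z.
  by move: Oz; near: z.
exists ((fun z => Num.max (Psi' z) 0) \_ D); last first.
  near=> z => Dz; rewrite patchE mem_set//.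
  have -> : Psi' z = Psi z by have := DOO _ Dz; near: z.
  by apply/esym/max_idPl; have := DOO _ Dz; near: z.
split.
- apply: (iffLR (measurable_restrictT _ mD)).
  by apply: measurable_maxr => //; exact: measurable_funS mPsi'.
- by move=> z; rewrite patchE; case: ifPn => // _; rewrite le_max lexx orbT.
- by move=> z nD; rewrite patchE memNset.
apply: filterS (ae_xsection Psi'0) => x Psi'x Ox.
have [<- supp] := rep _ Ox.
have mx : measurable_fun setT (fun y => ((Psi' \_ (Omega `*` Omega)) (x, y))).
  apply: measurableT_comp => //.
  exact: (iffLR (measurable_restrictT _ mOO)).
have xE : (fun y => (Psi' (x, y))%:E) \_ Omega =
    (fun y => ((Psi' \_ (Omega `*` Omega)) (x, y))%:E).
  apply/funext => y; rewrite !patchE; case: ifPn; rewrite (inE, notin_setE) => Oy.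
    by rewrite mem_set.
  by rewrite memNset// => -[].
rewrite [RHS]integral_mkcond xE; apply: ae_eq_integral => //.
- apply/measurable_EFinP; apply: measurableT_comp => //.
  apply: (iffLR (measurable_restrictT _ mD)).
  by apply: measurable_maxr => //; exact: measurable_funS mPsi'.
- exact/measurable_EFinP.
near=> y => _; congr EFin; rewrite !patchE.
have [Oy|nOy] := pselect (Omega y); last first.
  by rewrite !memNset// => -[].
rewrite [in RHS]mem_set//; have [xy|xy] := ltP (enorm (x - y)) eps.
  rewrite mem_set//; apply/max_idPl.
  have : (Omega `*` Omega) (x, y) -> 0 <= Psi' (x, y) by near: y.
  by apply.
rewrite memNset; last by move=> [_ _ /=]; rewrite ltNge xy.
apply/esym; have : Omega y -> ~ ess_supp Omega (fun y => Psi' (x, y)) y ->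
  Psi' (x, y) = 0 by near: y; exact: ess_supp_ae.
apply => // /supp[/closure_eball/= yx _].
have : enorm (x - y) != eps by near: y; exact: ae_distance_neq.
by rewrite eq_le yx xy.
Unshelve. all: by end_near. Qed.

(** The hypothesis is tested on the set where [f] is negative: there the integral of the absolute
    value of [f] is both nonnegative and nonpositive. *)
Lemma density_ae_ge0 (f : T -> R) : leb.-integrable Omega (EFin \o f) ->
  (forall A, measurable A -> A `<=` Omega -> (0 <= \int[leb]_(x in A) (f x)%:E)%E) ->
  \forall x \ae leb, Omega x -> 0 <= f x.
Proof.
move=> fi f0; have mf : measurable_fun Omega f.
  by apply/measurable_EFinP; exact: measurable_int fi.
pose A := Omega `&` f @^-1` `]-oo, 0[%classic.
have mA : measurable A by exact: mf.
have mfA : measurable_fun A (EFin \o f).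
  by apply/measurable_EFinP; apply: measurable_funS mf => // x [].
have : (\int[leb]_(x in A) `|(f x)%:E| = 0)%E.
  apply/eqP; rewrite eq_le integral_ge0 ?andbT//.
  rewrite (eq_integral (fun x => - (f x)%:E))%E; last first.
    by move=> x; rewrite inE /A/= in_itv/= => -[_ fx0]; rewrite /= ltr0_norm.
  rewrite integralN; last first.
    by apply/integrable_add_def => //; apply: integrableS fi => // x [].
  by rewrite oppe_le0 f0// => x [].
move=> /(ae_eq_integral_abs leb mA mfA); apply: filterS => x fx Ox.
rewrite leNgt; apply/negP => fx0.
have Ax : A x by split => //=; rewrite in_itv.
by have [fx00] := fx Ax; rewrite fx00 ltxx in fx0.
Qed.

End general_kernels.

(** * The total variation as the supremum of the pairings *)

Section total_variation_as_supremum.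
Context (R : realType) (N : nat) (eps : R) (eps_gt0 : 0 < eps)
  (Omega : set 'rV[R]_N) (mOmega : measurable Omega) (oOmega : open Omega).
Local Notation T := 'rV[R]_N.
Local Notation leb := (lebesgue_rV R N).
Local Notation leb2 := (leb \x leb)%E.
Local Notation D := (close_pairs eps Omega).
Context (rho : bool -> T -> R)
  (rhoi : forall i, leb.-integrable Omega (EFin \o rho i))
  (rho0 : forall i, \forall x \ae leb, Omega x -> 0 <= rho i x).

(** A density of a measure is nonnegative only almost everywhere, whereas the bounds on the gain ask
    for a weight nonnegative at every point of [Omega]. *)
Let r i x := Num.max (rho i x) 0.

Let rhoE i : \forall x \ae leb, Omega x -> rho i x = r i x.
Proof. by apply: filterS (@rho0 i) => x h Ox; apply/esym/max_idPl/h. Qed.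

Let mrho i : measurable_fun Omega (rho i).
Proof. by apply/measurable_EFinP; exact: measurable_int (@rhoi i). Qed.

Let mr i : measurable_fun Omega (r i).
Proof. exact: measurable_maxr. Qed.

Let ri i : leb.-integrable Omega (EFin \o r i).
Proof. exact: ae_eq_integrable (@rhoE i) (@rhoi i). Qed.

Let r0 i x : Omega x -> 0 <= r i x.
Proof. by rewrite /r le_max lexx orbT. Qed.

Definition pairing (Psi : bool -> T * T -> R) (v : T -> R) : R :=
  - (\int[leb]_(x in Omega)
      (v x * div_eps eps Omega (weighted_kernel Psi rho) x)).

Lemma ae_boundedN (v : T -> R) : ae_bounded Omega v -> ae_bounded Omega (\- v).
Proof.
by case=> M vM; exists M; apply: filterS vM => x vM Ox /=; rewrite normrN; exact: vM.
Qed.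

Lemma half_TV_rho i (v : T -> R) : measurable_fun setT v -> ae_bounded Omega v ->
  \int[leb]_(x in Omega) ((ess_sup_eball eps mOmega v x - v x) / eps * rho i x) =
  half_TV eps mOmega v (r i).
Proof.
move=> mv bv; have mq : measurable_fun Omega
    (fun x => (ess_sup_eball eps mOmega v x - v x) / eps).
  apply: measurable_funM => //; apply: measurable_funB.
    exact: measurable_ess_sup_eball.
  exact: measurable_funTS.
apply: ae_eq_Rintegral => //; try exact: measurable_funM.
by apply: filterS (rhoE i) => x h Ox; rewrite h.
Qed.

(** An essential infimum is minus the essential supremum of [\- v], so only suprema have to be
    estimated. *)
Lemma TVE (v : T -> R) : measurable_fun setT v -> ae_bounded Omega v ->
  TV eps mOmega rho v =
  half_TV eps mOmega v (r false) + half_TV eps mOmega (\- v) (r true).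
Proof.
move=> mv bv; rewrite /TV half_TV_rho//; congr (_ + _).
rewrite -half_TV_rho; last 2 first.
  exact: measurableT_comp.
  exact: ae_boundedN.
apply: eq_Rintegral => x _; congr (_ / _ * _).
by rewrite /ess_inf_eball ess_infEN fineN opprK/= opprK addrC.
Qed.

Section kernels.
Variables (Psi : bool -> T * T -> R)
  (tPsi : forall i, transport_kernels eps Omega (Psi i)).

Lemma weighted_kernel_ae k : (forall i, transport_density eps Omega (k i)) ->
  (forall i, \forall z \ae leb2, D z -> Psi i z = k i z) ->
  [/\ forall i, leb2.-integrable D (EFin \o (fun z => r i z.1 * k i z)),
      leb2.-integrable D (EFin \o weighted_kernel Psi rho) &
      \forall z \ae leb2, D z -> weighted_kernel Psi rho z =
        r false z.1 * k false z - r true z.1 * k true z].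
Proof.
move=> dk PsiE; have mD : measurable D := measurable_close_pairs eps mOmega.
have rki i : leb2.-integrable D (EFin \o (fun z => r i z.1 * k i z)).
  by have [] := density_marginal mOmega (dk i) (ri i).
have WE : \forall z \ae leb2, D z -> weighted_kernel Psi rho z =
    r false z.1 * k false z - r true z.1 * k true z.
  have hf := ae_fst leb (rhoE false); have ht := ae_fst leb (rhoE true).
  have pf := PsiE false; have pt := PsiE true.
  near=> z => Dz; have [z1 _ _] := Dz.
  have -> : r false z.1 = rho false z.1 by apply/esym; move: z1; near: z.
  have -> : r true z.1 = rho true z.1 by apply/esym; move: z1; near: z.
  have -> : k false z = Psi false z by apply/esym; move: Dz; near: z.
  have -> : k true z = Psi true z by apply/esym; move: Dz; near: z.
  by rewrite /weighted_kernel mulrC; congr (_ - _); rewrite mulrC.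
split=> //.
have := integrableB mD (rki false) (rki true).
apply: ae_eq_integrable => //; last first.
  by apply: filterS WE => z h Dz; rewrite (h Dz).
have mP i : measurable_fun D (Psi i).
  have [/measurable_int/measurable_EFinP + _ _] := tPsi i.
  by apply: measurable_funS; [exact: measurableX|move=> z []].
have mR i : measurable_fun D (fun z : T * T => rho i z.1).
  apply: (@measurable_comp _ _ _ _ _ _ Omega) => //.
    by move=> _ [z [Oz _ _]] <-.
  exact: measurable_funTS.
by apply: measurable_funB; exact: measurable_funM.
Unshelve. all: by end_near. Qed.

(** The kernel is named by an equation: linearity in [v] treats it as an opaque integrable function,
    convexity in the kernels opens it. *)
Lemma pairingE : exists f,
  [/\ leb2.-integrable D (EFin \o f),
      f = weighted_kernel Psi rho &
      forall v, measurable_fun setT v -> ae_bounded Omega v ->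
        pairing Psi v = \int[leb2]_(z in D) ((v z.2 - v z.1) / eps * f z)].
Proof.
have /choice[k kP] : forall i, exists k, transport_density eps Omega k /\
    \forall z \ae leb2, D z -> Psi i z = k z.
  by move=> i; have [k] := transport_kernel_density eps_gt0 mOmega (tPsi i); exists k.
have [_ Wi _] := weighted_kernel_ae (fun i => (kP i).1) (fun i => (kP i).2).
exists (weighted_kernel Psi rho); split => // v mv bv.
exact: pairing_divergence.
Qed.

Lemma pairing_gain k v : (forall i, transport_density eps Omega (k i)) ->
  (forall i, \forall z \ae leb2, D z -> Psi i z = k i z) ->
  measurable_fun setT v -> ae_bounded Omega v ->
  pairing Psi v = transport_gain eps Omega v (r false) (k false) +
                  transport_gain eps Omega (\- v) (r true) (k true).
Proof.
move=> dk PsiE mv bv; have mD : measurable D := measurable_close_pairs eps mOmega.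
have [rki Wi WE] := weighted_kernel_ae dk PsiE.
have mNv : measurable_fun setT (\- v) by exact: measurableT_comp.
have bNv := ae_boundedN bv.
rewrite /pairing (pairing_divergence mOmega mv bv Wi) /transport_gain.
rewrite -RintegralD//; last 2 first.
  exact: integrable_difference_quotient.
  exact: integrable_difference_quotient.
apply: ae_eq_Rintegral => //.
- apply/measurable_EFinP; apply: measurable_int.
  exact: integrable_difference_quotient Wi.
- apply: measurable_funD; apply/measurable_EFinP; apply: measurable_int.
    exact: integrable_difference_quotient (rki false).
  exact: integrable_difference_quotient (rki true).
apply: filterS WE => z WE Dz; rewrite WE// mulrBr; congr (_ + _).
by rewrite -mulNr -mulNr !opprD !opprK.
Qed.

Lemma pairing_le_TV v : measurable_fun setT v -> ae_bounded Omega v ->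
  pairing Psi v <= TV eps mOmega rho v.
Proof.
move=> mv bv; have /choice[k kP] : forall i, exists k,
    transport_density eps Omega k /\
    \forall z \ae leb2, D z -> Psi i z = k z.
  by move=> i; have [k] := transport_kernel_density eps_gt0 mOmega (tPsi i); exists k.
rewrite (pairing_gain (fun i => (kP i).1) (fun i => (kP i).2))// TVE//.
apply: lerD; apply: gain_le => //; try exact: (kP _).1.
- exact: r0.
- exact: measurableT_comp.
- exact: ae_boundedN.
- exact: r0.
Qed.

Lemma pairing_linear a v w : measurable_fun setT v -> ae_bounded Omega v ->
  measurable_fun setT w -> ae_bounded Omega w ->
  pairing Psi (fun x => a * v x + w x) = a * pairing Psi v + pairing Psi w.
Proof.
move=> mv bv mw bw; have mD : measurable D := measurable_close_pairs eps mOmega.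
have [f [fi _ fE]] := pairingE.
rewrite !fE//; last 2 first.
- by apply: measurable_funD => //; exact: measurable_funM.
- have [M vM] := bv; have [M' wM'] := bw; exists (`|a| * M + M').
  near=> x => Ox; rewrite (le_trans (ler_normD _ _))// lerD//.
    by rewrite normrM ler_wpM2l//; move: Ox; near: x.
  by move: Ox; near: x.
rewrite -RintegralZl//; last exact: integrable_difference_quotient.
rewrite -RintegralD//; last 2 first.
  exact: (integrableZl mD a (integrable_difference_quotient mOmega mv bv fi)).
  exact: integrable_difference_quotient.
apply: eq_Rintegral => z _; rewrite mulrA -mulrDl; congr (_ * _).
by rewrite mulrA -mulrDl mulrBr; congr (_ / _); rewrite opprD addrACA.
Unshelve. all: by end_near. Qed.

End kernels.

Hypothesis Omegay : (leb Omega < +oo)%E.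

(** The two kernels enter the pairing additively, so each is chosen for its own half of the total
    variation, with half of the margin. *)
Lemma pairing_near_TV v eta : measurable_fun setT v -> ae_bounded Omega v ->
  0 < eta ->
  exists2 k, (forall i, exact_transport_density eps Omega (k i)) &
    TV eps mOmega rho v - eta <= pairing k v.
Proof.
move=> mv bv eta0; have eta20 : 0 < eta / 2 by rewrite divr_gt0.
have [k0 ek0 h0] := gain_near_sup mOmega eps_gt0 oOmega mv bv (ri false)
  (@r0 false) Omegay eta20.
have mNv : measurable_fun setT (\- v) by exact: measurableT_comp.
have [k1 ek1 h1] := gain_near_sup mOmega eps_gt0 oOmega mNv (ae_boundedN bv)
  (ri true) (@r0 true) Omegay eta20.
pose k i := if i then k1 else k0.
have ek i : exact_transport_density eps Omega (k i) by case: i.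
exists k => //; rewrite (@pairing_gain k _ k).
- rewrite TVE// [eta]splitr opprD addrACA; exact: lerD.
- by move=> i; exact: exact_transport_kernel.
- by move=> i; exact: exact_transport_densityW.
- by move=> i; exact: aeW.
- by [].
- by [].
Qed.

Lemma exact_transport_density_conv t k k' : 0 <= t <= 1 ->
  exact_transport_density eps Omega k -> exact_transport_density eps Omega k' ->
  exact_transport_density eps Omega (fun z => t * k z + (1 - t) * k' z).
Proof.
move=> /andP[t0 t1] [mk k0 kD k1] [mk' k'0 k'D k'1]; split.
- by apply: measurable_funD; exact: measurable_funM.
- by move=> z; rewrite addr_ge0// mulr_ge0// subr_ge0.
- by move=> z nD; rewrite kD// k'D// !mulr0 addr0.
move=> x Ox; under eq_integral => y _ do rewrite EFinD !EFinM.
have s0 : 0 <= 1 - t by rewrite subr_ge0.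
have mx (h : T * T -> R) : measurable_fun setT h ->
    measurable_fun setT (fun y => (h (x, y))%:E).
  by move=> mh; apply/measurable_EFinP; exact: (measurableT_comp mh).
rewrite ge0_integralD//; last 4 first.
- by move=> y _; rewrite mule_ge0// lee_fin.
- by apply: measurable_funeM; exact: mx.
- by move=> y _; rewrite mule_ge0// lee_fin.
- by apply: measurable_funeM; exact: mx.
rewrite !ge0_integralZl_EFin//; try exact: mx.
- by rewrite k1// k'1// !mule1 -EFinD addrC subrK.
- by move=> y _; rewrite lee_fin.
- by move=> y _; rewrite lee_fin.
Qed.

Lemma pairing_conv t k k' v : 0 <= t <= 1 ->
  (forall i, exact_transport_density eps Omega (k i)) ->
  (forall i, exact_transport_density eps Omega (k' i)) ->
  measurable_fun setT v -> ae_bounded Omega v ->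
  pairing (fun i z => t * k i z + (1 - t) * k' i z) v =
  t * pairing k v + (1 - t) * pairing k' v.
Proof.
move=> t01 ek ek' mv bv; have mD : measurable D := measurable_close_pairs eps mOmega.
have tk (h : bool -> T * T -> R) :
    (forall i, exact_transport_density eps Omega (h i)) ->
    forall i, transport_kernels eps Omega (h i).
  by move=> eh i; exact: exact_transport_kernel.
have [f [fi fW fE]] := pairingE (tk _ ek).
have [f' [f'i f'W f'E]] := pairingE (tk _ ek').
have [g [gi gW gE]] := pairingE (tk _ (fun i =>
  exact_transport_density_conv t01 (ek i) (ek' i))).
rewrite fE// f'E// gE// -!RintegralZl//; try exact: integrable_difference_quotient.
rewrite -RintegralD//; last 2 first.
  exact: (integrableZl mD _ (integrable_difference_quotient mOmega mv bv fi)).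
  exact: (integrableZl mD _ (integrable_difference_quotient mOmega mv bv f'i)).
apply: eq_Rintegral => z _; rewrite mulrCA [in RHS](mulrCA (1 - t)) -mulrDr.
congr (_ * _); rewrite gW fW f'W /weighted_kernel !mulrBr !mulrDl !mulrA.
by rewrite opprD addrACA.
Qed.

End total_variation_as_supremum.

(** * Separation in finite dimension *)

Section finite_dimensional_separation.
Context (R : realType) (n : nat).
Implicit Types (x y p c : 'I_n -> R) (K : set ('I_n -> R)).

(* A point [x] of [K] almost nearest to [p] is improved by moving slightly
   towards a point of [K] that is almost extremal in the direction [p - x]. *)
Lemma weakly_separated_close K p B : K !=set0 ->
  (forall x y t, K x -> K y -> 0 <= t <= 1 ->
     K (fun i => t * x i + (1 - t) * y i)) ->
  (forall x i, K x -> `|x i| <= B) ->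
  (forall c eta, 0 < eta -> exists2 y, K y &
     \sum_i c i * p i - eta <= \sum_i c i * y i) ->
  forall delta, 0 < delta -> exists2 y, K y & \sum_i (y i - p i) ^+ 2 < delta.
Proof.
move=> [x0 Kx0] cK bK sK delta delta0.
pose dist y := \sum_i (y i - p i) ^+ 2.
have dist0 y : 0 <= dist y by apply: sumr_ge0 => i _; exact: sqr_ge0.
pose E := dist @` K.
have infE : has_inf E.
  by split; [exists (dist x0), x0|exists 0 => _ [y _ <-]].
pose d2 := inf E.
have d2_le y : K y -> d2 <= dist y.
  by move=> Ky; apply: ge_inf; [exact: infE.2|exists y].
have d2_near e : 0 < e -> exists2 y, K y & dist y < d2 + e.
  by move=> e0; have [_ [y Ky <-] ye] := inf_adherent e0 infE; exists y.
have [d2delta|deltad2] := ltP d2 delta.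
  have [|y Ky yd] := d2_near (delta - d2); first by rewrite subr_gt0.
  by exists y => //; rewrite addrC subrK in yd.
exfalso; have d20 : 0 < d2 by exact: lt_le_trans deltad2.
pose B2 := \sum_(i < n) (B + B) ^+ 2.
have B2_ge x y : K x -> K y -> \sum_i (y i - x i) ^+ 2 <= B2.
  move=> Kx Ky; apply: ler_sum => i _; rewrite -real_normK ?num_real//.
  rewrite lerXn2r ?nnegrE//.
    by have := bK _ i Kx; have := normr_ge0 (x i); lra.
  by apply: (le_trans (ler_normB _ _)); apply: lerD; exact: bK.
have B20 : 0 <= B2 by apply: sumr_ge0 => i _; exact: sqr_ge0.
(* Since the squared length [V] of [y - x] is at most [C] and [t * C = d2 / 2], the quadratic term
   of [dist z] is at most [t * d2 / 2]. Choosing [y] extremal up to [dist x / 4] makes the linear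
   decrease at least [3 / 2 * t * d2]. The net decrease, at least [t * d2], exceeds [dist x - d2].
   Adding [d2] to [B2] makes [C] positive and [t <= 1]. *)
pose C := B2 + d2; have C0 : 0 < C by rewrite /C ltr_wpDl.
pose t := d2 / (2 * C).
have t0 : 0 < t by rewrite divr_gt0// mulr_gt0.
have tC : 2 * (t * C) = d2 by rewrite mulrCA mulfVK// gt_eqF// mulr_gt0.
have t1 : t <= 1 by rewrite ler_pdivrMr ?mulr_gt0// mul1r /C; lra.
have [|x Kx xd] := d2_near (t * d2); first by rewrite mulr_gt0.
have xd2 := d2_le _ Kx.
pose c i := p i - x i.
have [|y Ky cy] := sK c (dist x / 4); first by lra.
pose z i := t * y i + (1 - t) * x i.
have Kz : K z by apply: cK => //; rewrite (ltW t0).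
have zE : dist z = dist x - 2 * t * (\sum_i c i * y i - \sum_i c i * x i)
    + t ^+ 2 * \sum_i (y i - x i) ^+ 2.
  rewrite -sumrB !mulr_sumr -sumrB -big_split; apply: eq_bigr => i _ /=.
  by rewrite /z /c; lra.
have xE : dist x = \sum_i c i * p i - \sum_i c i * x i.
  by rewrite -sumrB; apply: eq_bigr => i _; rewrite /c; lra.
have W := B2_ge _ _ Kx Ky.
have := d2_le _ Kz; apply/negP; rewrite -ltNge zE.
set Y := \sum_i c i * y i in cy *; set X := \sum_i c i * x i in xE *.
set P := \sum_i c i * p i in cy xE; set V := \sum_i (y i - x i) ^+ 2 in W *.
have YX : 3 / 4 * dist x <= Y - X by lra.
have h1 : t * (3 / 4 * dist x) <= t * (Y - X) by rewrite ler_pM2l.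
have h2 : t ^+ 2 * V <= t * (t * C).
  by rewrite expr2 -mulrA !ler_pM2l//; rewrite /C; lra.
have h3 : t * d2 <= t * dist x by rewrite ler_pM2l.
have h4 : t * (2 * (t * C)) = t * d2 by rewrite tC.
by lra.
Qed.

End finite_dimensional_separation.

(** * Integration against bounded charges *)

Section bounded_charges.
Context d (T : measurableType d) (R : realType) (m : {measure set T -> \bar R})
  (nu : {additive_charge set T -> \bar R}) (M : R)
  (nuM : forall A, measurable A -> (`|nu A| <= M%:E)%E)
  (num : content_dominates m nu).

Local Notation nuR A := (fine (nu A)).

Lemma additive_charge0 : nu set0 = 0%E.
Proof.
have /[!big_ord0] ->// := @charge_semi_additive _ _ _ nu (fun=> set0) 0%N.
exact: trivIset_set0.
Qed.

Lemma additive_chargeE A : measurable A -> nu A = (nuR A)%:E.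
Proof. by move=> mA; rewrite fineK//; exact: fin_num_measure. Qed.

Lemma additive_chargeU A B : measurable A -> measurable B -> A `&` B = set0 ->
  nuR (A `|` B) = nuR A + nuR B.
Proof.
move=> mA mB AB; rewrite -fineD; try exact: fin_num_measure.
congr fine; apply: (semi_additiveW additive_charge0 charge_semi_additive) => //.
exact: measurableU.
Qed.

Lemma additive_charge_bigsetU (I : eqType) (s : seq I) (P : pred I)
    (A : I -> set T) : uniq s -> (forall i, measurable (A i)) ->
  (forall i j, i != j -> A i `&` A j = set0) ->
  nuR (\big[setU/set0]_(i <- s | P i) A i) = \sum_(i <- s | P i) nuR (A i).
Proof.
move=> + mA dA; elim: s => [|i s ih] /=; first by rewrite !big_nil additive_charge0.
move=> /andP[ni /ih {}ih]; rewrite !big_cons; case: ifP => // Pi.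
rewrite additive_chargeU ?ih//; first exact: bigsetU_measurable.
rewrite big_distrr/= big_seq_cond big1// => j /andP[js _]; apply: dA.
by apply: contraNneq ni => ->.
Qed.

Lemma additive_charge_le A : measurable A -> `|nuR A| <= M.
Proof. by move=> mA; rewrite -lee_fin -abse_EFin -additive_chargeE// nuM. Qed.

Section fibers.
Variables (K : choiceType) (q : T -> K) (ks : seq K).
Hypotheses (uks : uniq ks) (qks : forall x, q x \in ks)
  (mq : forall k, measurable (q @^-1` [set k])).

Let dq k l : k != l -> q @^-1` [set k] `&` q @^-1` [set l] = set0.
Proof.
move=> /eqP kl; apply/seteqP; split => // x [/= xk xl]; apply: kl.
by rewrite -xk -xl.
Qed.

(** Since [h] may take a value at several [k], a level set of [h \o q] is a disjoint union of
    fibers. With [q] the pair of two simple functions, both are integrated over one partition, which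
    gives additivity. *)
Lemma sintegral_fibers (h : K -> R) :
  sintegral nu (h \o q) =
  (\sum_(k <- ks) h k * nuR (q @^-1` [set k]))%:E.
Proof.
pose xs := undup (map h ks).
have fibE x : (h \o q) @^-1` [set x] =
    \big[setU/set0]_(k <- ks | h k == x) q @^-1` [set k].
  rewrite -bigcup_seq_cond; apply/seteqP; split=> [y /= <-|y [k /= /andP[_ /eqP <-]] ->//].
  by exists (q y) => //=; rewrite qks eqxx.
rewrite /sintegral -(@fsbig_widen _ _ _ _ [set` xs])//; last first.
  move=> x /= [_ nx]; rewrite (_ : _ @^-1` _ = set0) ?additive_charge0 ?mule0//.
  apply/seteqP; split => // y /= hy; apply: nx.
  by rewrite /= mem_undup -hy map_f.
rewrite -fsbig_seq ?undup_uniq//.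
under eq_bigr => x _.
  rewrite fibE additive_chargeE; last by apply: bigsetU_measurable => i _; exact: mq.
  rewrite additive_charge_bigsetU// -EFinM big_distrr/=; over.
rewrite sumEFin; congr EFin.
rewrite (exchange_big_dep xpredT)//=; apply: eq_big_seq => k kks.
rewrite -big_filter (_ : [seq x <- xs | h k == x] = [:: h k]) ?big_seq1//.
rewrite -[RHS](@filter_pred1_uniq _ xs) ?undup_uniq ?mem_undup ?map_f//.
by apply: eq_filter => x; rewrite /= eq_sym.
Qed.

Lemma sum_fibers_bound (s : pred K) :
  `|\sum_(k <- ks | s k) nuR (q @^-1` [set k])| <= M.
Proof.
rewrite -additive_charge_bigsetU//; apply: additive_charge_le.
by apply: bigsetU_measurable => i _; exact: mq.
Qed.

(** The fibers of nonnegative charge and those of negative charge form two sets, each of charge at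
    most [M] in absolute value. This is the origin of the constant [M + M] below. *)
Lemma variation_fibers_bound :
  \sum_(k <- ks) `|nuR (q @^-1` [set k])| <= M + M.
Proof.
rewrite (bigID (fun k => 0 <= nuR (q @^-1` [set k])))/=; apply: lerD.
  under eq_bigr => k k0 do rewrite ger0_norm//.
  exact: le_trans (ler_norm _) (sum_fibers_bound _).
under eq_bigr => k k0.
  rewrite ltr0_norm; last by rewrite ltNge.
  over.
rewrite sumrN; apply: le_trans (ler_norm _) _; rewrite normrN.
exact: sum_fibers_bound.
Qed.

End fibers.

Definition simple_function (f : T -> R) :=
  measurable_fun setT f /\ finite_set (range f).

Local Notation I f := (fine (sintegral nu f)).

Lemma simple_values f : simple_function f -> exists ks : seq R,
  [/\ uniq ks, forall x, f x \in ks & forall k, measurable (f @^-1` [set k])].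
Proof.
move=> [mf /finite_seqP[s fs]]; exists (undup s); split.
- exact: undup_uniq.
- move=> x; rewrite mem_undup; have : range f (f x) by exists x.
  by rewrite fs.
- by move=> k; rewrite -[X in measurable X]setTI; exact: mf.
Qed.

Lemma sintegral_chargeE f : simple_function f -> sintegral nu f = (I f)%:E.
Proof.
move=> /simple_values[ks [uks fks mf]].
by rewrite -[f]/(id \o f) (sintegral_fibers uks fks mf).
Qed.

Lemma simple_lincomb a f g : simple_function f -> simple_function g ->
  simple_function (fun x => a * f x + g x) /\
  I (fun x => a * f x + g x) = a * I f + I g.
Proof.
move=> sf sg; have [xs [ux fx mf]] := simple_values sf.
have [ys [uy gy mg]] := simple_values sg.
pose ks := [seq (x, y) | x <- xs, y <- ys].
pose q x := (f x, g x).
have uks : uniq ks by apply: allpairs_uniq => // -[? ?] [? ?].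
have qks x : q x \in ks by rewrite allpairs_f.
have mq k : measurable (q @^-1` [set k]).
  rewrite (_ : _ @^-1` _ = f @^-1` [set k.1] `&` g @^-1` [set k.2]).
    exact: measurableI.
  apply/seteqP; split=> [x /= <-//|x []/=]; rewrite /q => -> ->.
  by case: k.
split.
  split; first by apply: measurable_funD; [apply: measurable_funM => //; exact: sf.1|exact: sg.1].
  apply: (@sub_finite_set _ _ ((fun k => a * k.1 + k.2) @` [set` ks])).
    by move=> _ [x _ <-]; exists (q x) => //; exact: qks.
  exact: finite_image.
rewrite -[fun x => _]/((fun k : R * R => a * k.1 + k.2) \o q).
rewrite -[in X in a * X](_ : fst \o q = f)// -[in X in _ + X](_ : snd \o q = g)//.
rewrite !(sintegral_fibers uks qks mq)/= big_distrr -big_split/=.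
by apply: eq_bigr => k _; rewrite mulrDl mulrA.
Qed.

(** A value exceeding [c] in absolute value is taken on a null set of [m], which [nu] does not
    charge. *)
Lemma simple_bound f c : 0 <= c -> simple_function f ->
  (\forall x \ae m, `|f x| <= c) -> `|I f| <= (M + M) * c.
Proof.
move=> c0 sf [B [mB B0 sB]]; have [ks [uks fks mf]] := simple_values sf.
rewrite -[f]/(id \o f) (sintegral_fibers uks fks mf)/=.
apply: (@le_trans _ _ (\sum_(k <- ks) `|nuR (f @^-1` [set k])| * c)); last first.
  by rewrite -mulr_suml ler_wpM2r//; exact: variation_fibers_bound.
apply: le_trans (ler_norm_sum _ _ _) _; apply: ler_sum => k _.
rewrite normrM mulrC; have [kc|kc] := leP `|k| c; first by rewrite ler_wpM2l.
rewrite num// ?normr0 ?mul0r//; apply: (subset_measure0 _ mB _ B0) => //.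
by move=> x /= fk; apply: sB => /=; rewrite fk leNgt kc.
Qed.

(* The value is the supremum of the lower estimates. *)
Lemma charge_integral_exists (v : T -> R) :
  (forall e, 0 < e -> exists2 f, simple_function f &
     \forall x \ae m, `|v x - f x| <= e) ->
  exists r : R, forall f c, simple_function f -> 0 <= c ->
    (\forall x \ae m, `|v x - f x| <= c) -> `|r - I f| <= (M + M) * c.
Proof.
move=> av.
have fg f c g e : simple_function f -> 0 <= c ->
    (\forall x \ae m, `|v x - f x| <= c) -> simple_function g -> 0 <= e ->
    (\forall x \ae m, `|v x - g x| <= e) ->
    I f - (M + M) * c <= I g + (M + M) * e.
  move=> sf c0 fc sg e0 ge.
  have [sgf Igf] := simple_lincomb (- 1) sg sf.
  have := simple_bound (addr_ge0 c0 e0) sgf.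
  rewrite Igf => bound; have : \forall x \ae m, `|- 1 * g x + f x| <= c + e.
    near=> x; rewrite (_ : _ + _ = (v x - g x) - (v x - f x)); last by lra.
    apply: le_trans (ler_normB _ _) _; rewrite addrC.
    by apply: lerD; near: x.
  move=> /bound/(le_trans (ler_norm _)); rewrite mulrDr; lra.
pose L := [set y | exists f c, [/\ simple_function f, 0 <= c,
  (\forall x \ae m, `|v x - f x| <= c) & y = I f - (M + M) * c]].
have [f0 sf0 vf0] := av 1 ltr01.
have supL : has_sup L.
  split; first by exists (I f0 - (M + M) * 1), f0, 1.
  exists (I f0 + (M + M) * 1) => _ [f [c [sf c0 fc ->]]].
  exact: fg.
exists (sup L) => f c sf c0 fc; rewrite ler_distl; apply/andP; split.
  by apply: ub_le_sup; [exact: supL.2|exists f, c].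
apply: ge_sup; first exact: supL.1.
by move=> _ [g [e [sg e0 ge ->]]]; exact: fg.
Unshelve. all: by end_near. Qed.

End bounded_charges.

(** * The essential supremum norm and uniform approximation by simple functions *)

Section essential_sup_norm.
Context d (T : measurableType d) (R : realType) (m : {measure set T -> \bar R}).
Local Notation "'N_oo f" := ('N[m]_+oo[EFin \o f])%E (at level 10, f at level 8).
Local Notation Linf := (LfunType m (leey 1%:E)).

Lemma Lnormy_leP (f : T -> R) c : 0 <= c ->
  ('N_oo f <= c%:E)%E <-> (\forall x \ae m, `|f x| <= c).
Proof.
(* The norm is an essential supremum only if the space has positive measure; otherwise it is 0 and
   every property holds almost everywhere. *)
move=> c0; rewrite unlock /Lnorm; case: ifPn => m0.
  split; first by move/ess_supP; apply: filterS => x; rewrite /= lee_fin.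
  by move=> fc; apply/ess_supP; apply: filterS fc => x; rewrite /= lee_fin.
split=> [_|_]; last by rewrite lee_fin.
by apply: measure0_ae; apply/eqP; rewrite eq_le measure_ge0 andbT leNgt.
Qed.

Lemma ae_bounded_Linfty (f : T -> R) c : measurable_fun setT f ->
  (\forall x \ae m, `|f x| <= c) -> exists w : Linf, (w : T -> R) = f.
Proof.
move=> mf fc; have fP : f \in Lfun m +oo.
  apply/andP; split; apply: mem_set => //=.
  apply: (@le_lt_trans _ _ `|c|%:E); last exact: ltry.
  apply/Lnormy_leP => //; apply: filterS fc => x /le_trans; apply; exact: ler_norm.
by exists (Lfun_Sub (leey 1%:E) fP).
Qed.

Lemma Linfty_ae_bounded (v : Linf) :
  \forall x \ae m, `|v x| <= fine ('N_oo v).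
Proof.
have Nf : 'N_oo v \is a fin_num.
  by rewrite ge0_fin_numE ?Lnorm_ge0//; exact: Lfunction_finite.
by apply/Lnormy_leP; rewrite ?fine_ge0 ?Lnorm_ge0// fineK.
Qed.

Lemma simple_bounded (f : T -> R) : simple_function f ->
  exists2 c, 0 <= c & forall x, `|f x| <= c.
Proof.
move=> /simple_values[ks [uks fks _]]; exists (\sum_(k <- ks) `|k|).
  exact: sumr_ge0.
by move=> x; rewrite (bigD1_seq (f x))//= lerDl; exact: sumr_ge0.
Qed.

Lemma simple_sfun (f : T -> R) : simple_function f ->
  exists s : {sfun T >-> R}, (s : T -> R) = f.
Proof.
move=> [mf ff]; have fP : f \in sfun by apply/andP; split; exact: mem_set.
by exists (sfun_Sub fP).
Qed.

Lemma sfun_simple (s : {sfun T >-> R}) : simple_function s.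
Proof. by split; [exact: measurable_funPT|exact: fimfunP]. Qed.

(** [v + c] is rounded down to a multiple of [e]. The multiple is a count of the thresholds passed,
    so that measurability is that of a sum of indicators. *)
Lemma simple_approximation (v : T -> R) c : measurable_fun setT v ->
  (\forall x \ae m, `|v x| <= c) -> forall e, 0 < e ->
  exists2 f, simple_function f & \forall x \ae m, `|v x - f x| <= e.
Proof.
(* Almost everywhere [v + c] lies between 0 and [c + c], so [n] thresholds suffice. They start at
   [e], so the count is the integer part of [(v + c) / e]; stopping at [n] keeps the range finite
   even where [v] is not bounded by [c]. *)
move=> mv vc e e0; pose n := Num.trunc ((c + c) / e).
pose b i x := (i.+1%:R * e <= v x + c).
pose f x := e * (\sum_(i < n) b i x)%:R - c.
exists f; first split.
- apply: measurable_funB => //; apply: measurable_funM => //.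
  rewrite (_ : (fun x => _) = (fun x => \sum_(i < n) \1_[set x | b i x] x)).
    apply: measurable_sum => i; apply: measurable_indic.
    rewrite (_ : [set x | b i x] = setT `&` (fun x => v x + c) @^-1` `[i.+1%:R * e, +oo[%classic).
      by apply: measurable_funD.
    by rewrite setTI; apply/seteqP; split => x /=; rewrite in_itv/= andbT.
  apply/funext => x; rewrite natr_sum; apply: eq_bigr => i _.
  rewrite indicE; congr (nat_of_bool _)%:R.
  by apply/idP/idP => [bx|/set_mem//]; exact: mem_set.
- apply: (@sub_finite_set _ _ ((fun k : nat => e * k%:R - c) @` `I_n.+1)).
    move=> _ [x _ <-]; exists (\sum_(i < n) b i x)%N => //=.
    rewrite ltnS -[leqRHS]card_ord -sum1_card.
    by apply: leq_sum => i _; case: (b i x).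
  by apply: finite_image; exact: finite_II.
apply: filterS vc => x vx; pose w := v x + c.
have /andP[w0 w2] : 0 <= w <= c + c by move: vx; rewrite /w ler_norml; lra.
have we0 : 0 <= w / e by rewrite divr_ge0// ltW.
pose j := Num.trunc (w / e).
have jn : (j <= n)%N.
  rewrite truncn_ge_nat; last by rewrite divr_ge0 ?(ltW e0)//; exact: le_trans w2.
  have /andP[jw _] := truncn_itv we0; apply: (le_trans jw).
  by rewrite ler_pM2r ?invr_gt0.
have bE i : b i x = (i < j)%N by rewrite truncn_ge_nat// ler_pdivlMr.
have -> : f x = e * j%:R - c.
  rewrite /f; congr (_ * _%:R - _); under eq_bigr => i _ do rewrite bE.
  have -> : forall k, (\sum_(i < k) (i < j)%N = minn k j)%N; last exact/minn_idPr.
  elim=> [|k ih]; first by rewrite big_ord0 min0n.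
  by rewrite big_ord_recr/= ih; case: (ltnP k j) => kj /=; lia.
have /andP[jw wj] := truncn_itv we0; rewrite -/j in jw wj.
have h1 : e * j%:R <= w by rewrite mulrC -ler_pdivlMr.
have h2 : w <= e * j%:R + e.
  by rewrite -[X in _ + X]mulr1 -mulrDr mulrC -ler_pdivrMr// natr1 ltW.
by rewrite ler_norml; move: h1 h2; rewrite /w; lra.
Qed.

End essential_sup_norm.

Section integral_against_charges.
Context (R : realType) (N : nat) (Omega : set 'rV[R]_N)
  (mOmega : measurable Omega).
Local Notation m := (lebesgue_on mOmega).

(** As [ba_integral] is a choice by [get], [r] must be the only number with the defining property.
    The error bound shows that [r] has it; uniqueness requires an actual approximating sequence, for
    without one every real would qualify. *)
Lemma ba_integral_eq (nu : set 'rV[R]_N -> \bar R) (v : Linfty mOmega) (r C : R) :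
  (forall f, simple_function f -> sintegral nu f = (fine (sintegral nu f))%:E) ->
  (forall f c, simple_function f -> 0 <= c ->
    (\forall x \ae m, `|v x - f x| <= c) ->
    `|r - fine (sintegral nu f)| <= C * c) ->
  ba_integral mOmega nu v = r.
Proof.
move=> Ifin Ibound.
have mv : measurable_fun setT (v : _ -> R) by exact: measurable_funPT.
have rP (s : nat -> {sfun 'rV[R]_N >-> R}) :
    ('N[m]_+oo[EFin \o (v \- s n)%R])%E @[n --> \oo] --> 0%E ->
    sintegral nu (s n) @[n --> \oo] --> r%:E.
  move=> /fine_cvgP[Nfin N0].
  rewrite (_ : (fun n => sintegral nu (s n)) =
      (fun n => (fine (sintegral nu (s n)))%:E)); last first.
    by apply/funext => n; rewrite -Ifin//; exact: sfun_simple.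
  apply: cvg_EFin; first by apply: nearW.
  apply/cvgrPdist_le => e e0.
  have C0 : 0 < `|C| + 1 by rewrite ltr_wpDl.
  move/cvgrPdist_le : N0 => /(_ (e / (`|C| + 1))); rewrite divr_gt0// => /(_ isT) N0.
  near=> n.
  have Nn : ('N[m]_+oo[EFin \o (v \- s n)%R])%E \is a fin_num by near: n.
  have N0n : `|0 - fine ('N[m]_+oo[EFin \o (v \- s n)%R])%E| <= e / (`|C| + 1).
    by near: n.
  rewrite sub0r normrN ger0_norm in N0n; last by rewrite fine_ge0// Lnorm_ge0.
  have c0 : 0 <= e / (`|C| + 1) by rewrite divr_ge0// ltW.
  have := Ibound _ _ (sfun_simple (s n)) c0.
  move=> /(_ _)/le_trans; apply.
    by apply/(Lnormy_leP m _ c0); rewrite -(fineK Nn) lee_fin.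
  rewrite mulrCA; apply: (@le_trans _ _ (e * 1)); last by rewrite mulr1.
  rewrite ler_pM2l// ler_pdivrMr// mul1r; apply: (le_trans (ler_norm _)).
  by rewrite lerDl.
apply: get_unique => // y yP.
have /choice[s sP] : forall n : nat, exists s : {sfun 'rV[R]_N >-> R},
    \forall x \ae m, `|v x - s x| <= n.+1%:R^-1.
  move=> n; have [|f sf vf] := @simple_approximation _ _ _ m v _ mv
    (Linfty_ae_bounded v) n.+1%:R^-1; first by rewrite invr_gt0.
  by have [s sE] := simple_sfun sf; exists s; rewrite sE.
have sN : ('N[m]_+oo[EFin \o (v \- s n)%R])%E @[n --> \oo] --> 0%E.
  apply: (@squeeze_cvge _ _ _ _ (cst 0%E) _ (fun n => (n.+1%:R^-1)%:E)).
  - apply: nearW => n; rewrite Lnorm_ge0/=.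
    by apply/Lnormy_leP; rewrite ?invr_ge0//; exact: sP.
  - exact: cvg_cst.
  - apply: cvg_EFin; first exact: nearW.
    exact: cvg_harmonic.
apply: EFin_inj; exact: (cvg_unique (@ereal_hausdorff R) (yP _ sN) (rP _ sN)).
Unshelve. all: by end_near. Qed.

End integral_against_charges.

(** * Bounded functionals and bounded charges *)

Section charge_of_functional.
Context (R : realType) (N : nat) (Omega : set 'rV[R]_N)
  (mOmega : measurable Omega).
Local Notation T := 'rV[R]_N.
Local Notation m := (lebesgue_on mOmega).
Local Notation Linf := (Linfty mOmega).

Lemma LinftyDE (v w : Linf) x : (v + w) x = v x + w x.
Proof. by []. Qed.

(** The implication sits under the existential because a charge is a function on all sets; on
    nonmeasurable ones its value is irrelevant. *)
Lemma Linfty_indic_exists (A : set T) :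
  exists w : Linf, measurable A -> (w : T -> R) = \1_A.
Proof.
have [mA|nA] := pselect (measurable A); last by exists 0.
have [||w wE] := @ae_bounded_Linfty _ _ _ m (\1_A : T -> R) 1.
- exact: measurable_indic.
- apply: aeW => x; rewrite indicE; case: (_ \in _); rewrite ?normr1//.
  by rewrite normr0.
- by exists w.
Qed.

Definition Linfty_indic (A : set T) : Linf := sval (cid (Linfty_indic_exists A)).

Lemma Linfty_indicE A : measurable A -> (Linfty_indic A : T -> R) = \1_A.
Proof. exact: (svalP (cid (Linfty_indic_exists A))). Qed.

Lemma scalarD (phi : Linf -> R) (sphi : scalar phi) v w : phi (v + w) = phi v + phi w.
Proof. by have := sphi 1 v w; rewrite scale1r mul1r. Qed.

Lemma scalar0 (phi : Linf -> R) (sphi : scalar phi) : phi 0 = 0.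
Proof. by have := scalarD sphi 0 0; rewrite addr0; lra. Qed.

Lemma scalarZ (phi : Linf -> R) (sphi : scalar phi) a v : phi (a *: v) = a * phi v.
Proof. by have := sphi a v 0; rewrite addr0 scalar0// addr0. Qed.

Lemma scalarB (phi : Linf -> R) (sphi : scalar phi) v w : phi (v - w) = phi v - phi w.
Proof. by rewrite scalarD// -scaleN1r scalarZ// mulN1r. Qed.

Lemma Linfty_indic0 : Linfty_indic set0 = 0.
Proof. by apply/LfuneqP => x; rewrite Linfty_indicE// indic0. Qed.

Lemma Linfty_indicU A B : measurable A -> measurable B -> A `&` B = set0 ->
  Linfty_indic (A `|` B) = Linfty_indic A + Linfty_indic B.
Proof.
move=> mA mB AB; apply/LfuneqP => x.
rewrite LinftyDE !Linfty_indicE//; last exact: measurableU.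
rewrite !indicE in_setU; have [xA|xA] := boolP (x \in A); last by rewrite /= mulr0n add0r.
have [xB|_] := boolP (x \in B); last by rewrite /= mulr0n addr0.
by have : (A `&` B) x by [split; exact: set_mem]; rewrite AB.
Qed.

(** The proof of linearity is an argument of the term, so that the charge structure declared below
    can be inferred from the term. *)
Definition charge_of_functional (phi : Linf -> R) & scalar phi :=
  fun A : set T => (phi (Linfty_indic A))%:E.

Section charge_structure.
Variables (phi : Linf -> R) (sphi : scalar phi).
Local Notation nu := (charge_of_functional sphi).

Let nu_fin : fin_num_fun nu. Proof. by []. Qed.

HB.instance Definition _ := isFinite.Build _ T R nu nu_fin.

Let nu_additive : measure_function.semi_additive nu.
Proof.
move=> F n mF tF mUF; rewrite /charge_of_functional sumEFin; congr EFin.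
elim: n mUF => [|n ih] _; first by rewrite !big_ord0 Linfty_indic0 scalar0.
rewrite !big_ord_recr/= -ih; last exact: bigsetU_measurable.
rewrite Linfty_indicU ?scalarD//; first exact: bigsetU_measurable.
rewrite big_distrl/= big1// => i _; move/trivIsetP : tF; apply => //.
by rewrite neq_ltn ltn_ord.
Qed.

HB.instance Definition _ := isAdditiveCharge.Build _ T R nu nu_additive.

End charge_structure.

Section bounded_functional.
Variables (phi : Linf -> R) (sphi : scalar phi) (C : R)
  (phiC : forall v : Linf, `|phi v| <= C * fine ('N[m]_+oo[EFin \o v])%E).
Local Notation nu := (charge_of_functional sphi).

Lemma functional_bound (v : Linf) c : 0 <= c ->
  (\forall x \ae m, `|v x| <= c) -> `|phi v| <= `|C| * c.
Proof.
move=> c0 /Lnormy_leP-/(_ c0) vc; apply: (le_trans (phiC v)).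
have N0 : 0 <= fine ('N[m]_+oo[EFin \o v])%E by rewrite fine_ge0// Lnorm_ge0.
apply: (@le_trans _ _ (`|C| * fine ('N[m]_+oo[EFin \o v])%E)).
  by rewrite ler_wpM2r// ler_norm.
rewrite ler_wpM2l// -lee_fin fineK// ge0_fin_numE ?Lnorm_ge0//.
exact: Lfunction_finite.
Qed.

(** Indicators have norm at most 1, and norm 0 on null sets; continuity of [phi] turns this into
    boundedness and absolute continuity. *)
Lemma charge_of_functional_ba : ba mOmega nu.
Proof.
split.
  exists `|C| => A mA; rewrite /charge_of_functional lee_fin.
  rewrite -[leRHS]mulr1; apply: functional_bound => //; apply: aeW => x.
  by rewrite Linfty_indicE// indicE; case: (_ \in _); rewrite ?normr1// normr0.
move=> A mA A0; rewrite /charge_of_functional; congr EFin; apply/eqP.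
rewrite -normr_eq0 eq_le normr_ge0 andbT -[leRHS](mulr0 `|C|).
apply: functional_bound => //; exists A; split => // x /= nx.
apply: contrapT => nA; apply: nx.
by rewrite Linfty_indicE// indicE memNset// normr0.
Qed.

Lemma sintegral_charge_of_functional (v : Linf) : simple_function v ->
  sintegral nu v = (phi v)%:E.
Proof.
move=> /simple_values[ks [uks vks mv]].
rewrite -[X in sintegral _ X]/(id \o (v : T -> R)) (sintegral_fibers _ uks vks mv).
congr EFin; pose A k := (v : T -> R) @^-1` [set k].
(* [v] is rebuilt inside [Linf] as a combination of indicators of its level sets, where linearity of
   [phi] applies. *)
have [w [wE <-]] : exists w : Linf, (forall x, w x = \sum_(k <- ks) k * \1_(A k) x) /\
    phi w = \sum_(k <- ks) k * fine (nu (A k)).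
  elim: ks {uks vks} => [|k s [w [wE wphi]]].
    by exists 0; split=> [x|]; rewrite big_nil// scalar0.
  exists (k *: Linfty_indic (A k) + w); split => [x|].
    by rewrite big_cons -wE -Linfty_indicE//; exact: mv.
  by rewrite big_cons -wphi sphi.
congr phi; apply/LfuneqP => x; rewrite wE (bigD1_seq (v x))//=.
rewrite indicE mem_set// mulr1 big1 ?addr0// => k kv.
by rewrite indicE memNset ?mulr0// /A/= => vk; rewrite vk eqxx in kv.
Qed.

(** [phi] agrees with the integral on simple functions, and its continuity is exactly the estimate
    that determines the integral. *)
Lemma ba_integral_charge_of_functional (v : Linf) :
  ba_integral mOmega nu v = phi v.
Proof.
have simpleE f : simple_function f -> exists2 w : Linf, (w : T -> R) = f &
    sintegral nu f = (phi w)%:E.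
  move=> sf; have [c c0 fc] := simple_bounded sf.
  have [|w wE] := @ae_bounded_Linfty _ _ _ m f c sf.1; first exact: aeW.
  by exists w => //; rewrite -wE sintegral_charge_of_functional// wE.
apply: (ba_integral_eq (C := `|C|)) => [f /simpleE[w _ ->]//|f c sf c0 vf].
have [w wE ->] := simpleE _ sf; rewrite /= -scalarB//.
by apply: functional_bound => //; rewrite -wE in vf.
Qed.

End bounded_functional.

End charge_of_functional.

Section functional_of_charge.
Context (R : realType) (N : nat) (Omega : set 'rV[R]_N)
  (mOmega : measurable Omega).
Local Notation T := 'rV[R]_N.
Local Notation m := (lebesgue_on mOmega).
Local Notation Linf := (Linfty mOmega).
Variables (nu : {additive_charge set T -> \bar R}) (nuba : ba mOmega nu).

Lemma ba_integral_bound : exists M, 0 <= M /\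
  forall (v : Linf) f c, simple_function f -> 0 <= c ->
    (\forall x \ae m, `|v x - f x| <= c) ->
    `|ba_integral mOmega nu v - fine (sintegral nu f)| <= M * c.
Proof.
have [[M nuM] num] := nuba; exists (M + M); split.
  have := nuM set0 measurable0; rewrite additive_charge0 abse0 lee_fin => M0.
  exact: addr_ge0.
move=> v; have mv : measurable_fun setT (v : T -> R) by exact: measurable_funPT.
have [r rP] := charge_integral_exists nuM num (simple_approximation mv (Linfty_ae_bounded v)).
rewrite (ba_integral_eq (r := r) (C := M + M)) => //.
exact: sintegral_chargeE.
Qed.

Lemma ba_integral_dual : Linfty_dual (ba_integral mOmega nu : Linf -> R).
Proof.
have [[M0 nuM] num] := nuba; have [M [Mge0 MP]] := ba_integral_bound.
have approx (v : Linf) e : 0 < e -> exists2 f, simple_function f &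
    \forall x \ae m, `|v x - f x| <= e.
  have mv : measurable_fun setT (v : T -> R) by exact: measurable_funPT.
  exact: (simple_approximation mv (Linfty_ae_bounded v)).
split; last first.
  (* The norm bound is the approximation estimate for the zero simple function, whose integral
     vanishes. *)
  exists M => v; have sf0 : simple_function (cst 0 : T -> R).
    by split => //; apply: (sub_finite_set _ (finite_set1 (0 : R))) => _ [_ _ <-].
  have I0 : fine (sintegral nu (cst 0)) = 0.
    apply/eqP; rewrite -normr_le0.
    have := simple_bound nuM num (lexx 0) sf0; rewrite mulr0; apply.
    by apply: aeW => x; rewrite /= normr0.
  have := MP v _ (fine ('N[m]_+oo[EFin \o v])%E) sf0.
  rewrite I0 subr0; apply; first by rewrite fine_ge0// Lnorm_ge0.
  by apply: filterS (Linfty_ae_bounded v) => x; rewrite /= subr0.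
move=> a v w; apply/eqP; rewrite -subr_eq0 -normr_le0.
apply/ler_addgt0Pl => e e0; rewrite addr0.
(* With [f] and [g] within [t] of [v] and [w], the integral of the combination errs by at most
   [M * (|a| + 1) * t], and so does the combination of the two integrals. *)
pose K := M * (`|a| + 1) *+ 2.
have K0 : 0 <= K by rewrite mulrn_wge0// mulr_ge0// addr_ge0.
pose t := e / (K + 1).
have t0 : 0 < t by rewrite divr_gt0// ltr_wpDl.
have [f sf vf] := approx v _ t0; have [g sg wg] := approx w _ t0.
have [sfg Ifg] := simple_lincomb nu a sf sg.
have hv := MP v _ _ sf (ltW t0) vf; have hw := MP w _ _ sg (ltW t0) wg.
have c0 : 0 <= `|a| * t + t := addr_ge0 (mulr_ge0 (normr_ge0 a) (ltW t0)) (ltW t0).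
have avw : \forall x \ae m,
    `|(a *: v + w : Linf) x - (a * f x + g x)| <= `|a| * t + t.
  near=> x; rewrite (_ : _ - _ = a * (v x - f x) + (w x - g x)); last first.
    have -> : (a *: v + w : Linf) x = a * v x + w x by [].
    by lra.
  rewrite (le_trans (ler_normD _ _))// normrM; apply: lerD.
    by apply: ler_wpM2l => //; near: x.
  by near: x.
have := MP (a *: v + w) _ _ sfg c0 avw; rewrite Ifg.
set X := ba_integral _ _ _; set I := fine _ in hv; set J := fine _ in hw.
set V := ba_integral _ _ _ in hv *; set W := ba_integral _ _ _ in hw *.
move=> hvw; rewrite (_ : X - (a * V + W) =
  (X - (a * I + J)) - (a * (V - I) + (W - J))); last by lra.
apply: (@le_trans _ _ (K * t)).
  apply: (le_trans (ler_normB _ _)); rewrite /K mulr2n mulrDl; apply: lerD.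
    by rewrite -mulrA mulrDl mul1r.
  apply: (le_trans (ler_normD _ _)); rewrite normrM mulrDr mulr1 mulrDl.
  by apply: lerD => //; rewrite mulrAC [leRHS]mulrC ler_wpM2l.
rewrite /t mulrCA ler_piMr ?(ltW e0)// ler_pdivrMr ?ltr_wpDl// mul1r.
by rewrite lerDl.
Unshelve. all: by end_near. Qed.

End functional_of_charge.

(** * The subdifferential *)

Section weak_star_density.
Context (R : realType) (N : nat) (eps : R) (eps_gt0 : 0 < eps)
  (Omega : set 'rV[R]_N) (mOmega : measurable Omega) (oOmega : open Omega)
  (Omegay : (lebesgue_rV R N Omega < +oo)%E).
Local Notation T := 'rV[R]_N.
Local Notation leb := (lebesgue_rV R N).
Local Notation Linf := (Linfty mOmega).
Context (rho : bool -> T -> R)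
  (rhoi : forall i, leb.-integrable Omega (EFin \o rho i))
  (rho0 : forall i, \forall x \ae leb, Omega x -> 0 <= rho i x).
Local Notation tv := (TV eps mOmega rho).
Local Notation pair := (pairing eps Omega rho).
Local Notation exact_pair k := (forall i : bool, exact_transport_density eps Omega (k i)).

Lemma measurable_Linfty (v : Linf) : measurable_fun setT (v : T -> R).
Proof. exact: measurable_funPT. Qed.

Lemma Linfty_ae_boundedP (v : Linf) : ae_bounded Omega v.
Proof.
by exists (fine ('N[lebesgue_on mOmega]_+oo[EFin \o v])%E);
  apply/ae_mrestr/Linfty_ae_bounded.
Qed.

Lemma pairing_scalar (Psi : bool -> T * T -> R) :
  (forall i, transport_kernels eps Omega (Psi i)) ->
  scalar (fun v : Linf => pair Psi v).
Proof.
move=> tPsi a v w.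
exact: (pairing_linear eps_gt0 mOmega rhoi rho0 tPsi a (measurable_Linfty v)
  (Linfty_ae_boundedP v) (measurable_Linfty w) (Linfty_ae_boundedP w)).
Qed.

Lemma pairing_le (Psi : bool -> T * T -> R) (v : Linf) :
  (forall i, transport_kernels eps Omega (Psi i)) -> pair Psi v <= tv v.
Proof.
move=> tPsi.
exact: (pairing_le_TV eps_gt0 mOmega oOmega rhoi rho0 tPsi
  (measurable_Linfty v) (Linfty_ae_boundedP v)).
Qed.

Lemma exact_kernels k : exact_pair k -> forall i, transport_kernels eps Omega (k i).
Proof. by move=> ek i; exact: exact_transport_kernel. Qed.

Lemma pairing_near (v : Linf) eta : 0 < eta ->
  exists2 k, exact_pair k & tv v - eta <= pair k v.
Proof.
exact: (pairing_near_TV eps_gt0 mOmega oOmega rhoi rho0 Omegay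
  (measurable_Linfty v) (Linfty_ae_boundedP v)).
Qed.

(** A supremum of linear pairings is positively homogeneous. Only this inequality is used, for the
    factors 2 and 1/2. *)
Lemma TV_scale_le t (v : Linf) : 0 <= t -> tv (t *: v) <= t * tv v.
Proof.
move=> t0; apply/ler_addgt0Pl => e e0.
have [k ek] := pairing_near (t *: v) e0.
rewrite (scalarZ (pairing_scalar (exact_kernels ek))) lerBlDl => /le_trans; apply.
by rewrite lerD2l; apply: ler_wpM2l => //; exact: pairing_le (exact_kernels ek).
Qed.

(* If finitely many values of [phi] could not be approximated by kernels, a
   linear combination of the corresponding functions would violate
   [phi <= TV], which is the supremum over the kernels. *)
Lemma dominated_functional_close (phi : Linf -> R) : scalar phi ->
  (forall v, phi v <= tv v) -> forall (s : seq Linf) e, 0 < e ->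
  exists2 k, exact_pair k & forall v, v \in s -> `|pair k v - phi v| < e.
Proof.
move=> sphi phi_le s e e0; pose n := size s.
pose K := [set y : 'I_n -> R | exists2 k, exact_pair k &
  y = (fun i => pair k (s`_i : Linf))].
pose p (i : 'I_n) := phi (s`_i : Linf).
(* A pairing at [s_i] lies between [- tv (- s_i)] and [tv s_i], by linearity. *)
pose B := \sum_(i < n) (`|tv (s`_i : Linf)| + `|tv (- (s`_i : Linf))|).
have K_neq0 : K !=set0.
  have [k ek _] := pairing_near 0 ltr01.
  by exists (fun i => pair k (s`_i : Linf)), k.
have K_conv x y t : K x -> K y -> 0 <= t <= 1 ->
    K (fun i => t * x i + (1 - t) * y i).
  move=> [k ek ->] [k' ek' ->] t01; exists (fun i z => t * k i z + (1 - t) * k' i z).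
    by move=> i; exact: exact_transport_density_conv.
  apply/funext => i; apply/esym.
  exact: (pairing_conv eps_gt0 mOmega rhoi rho0 Omegay t01 ek ek'
    (measurable_Linfty _) (Linfty_ae_boundedP _)).
have K_bounded y i : K y -> `|y i| <= B.
  have bound (q a b r : R) : q <= a -> - q <= b -> 0 <= a -> 0 <= b -> 0 <= r ->
    `|q| <= a + b + r by rewrite ler_norml; lra.
  move=> [k ek ->]; rewrite /B (bigD1 i)//=; apply: bound => //.
  - exact: le_trans (pairing_le _ (exact_kernels ek)) (ler_norm _).
  - rewrite -mulN1r -(scalarZ (pairing_scalar (exact_kernels ek))) scaleN1r.
    exact: le_trans (pairing_le _ (exact_kernels ek)) (ler_norm _).
  - by apply: sumr_ge0 => j _; exact: addr_ge0.
have K_sup c eta : 0 < eta -> exists2 y, K y &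
    \sum_i c i * p i - eta <= \sum_i c i * y i.
  (* The direction [c] corresponds to a single test function [w]: [phi w <= tv w], and a kernel
     nearly optimal for [w] comes within [eta] of [tv w]. *)
  move=> eta0; pose w : Linf := \sum_(i < n) c i *: (s`_i : Linf).
  have sumE (psi : Linf -> R) : scalar psi ->
      psi w = \sum_(i < n) c i * psi (s`_i : Linf).
    move=> spsi; rewrite /w; elim/big_rec2: _ => [|i x v _ <-].
      exact: scalar0.
    exact: spsi.
  have [k ek kw] := pairing_near w eta0.
  exists (fun i => pair k (s`_i : Linf)); first by exists k.
  have := sumE _ (pairing_scalar (exact_kernels ek)) => /= <-.
  by rewrite -(sumE _ sphi); apply: le_trans kw; rewrite lerD2r.
have [y [k ek ->] yp] := weakly_separated_close K_neq0 K_conv K_bounded K_sup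
  (exprn_gt0 2 e0).
exists k => // v vs; have vn : (index v s < n)%N by rewrite index_mem.
have := yp; rewrite (bigD1 (Ordinal vn))//= /p /= nth_index// => h.
rewrite -(ltr_pXn2r (n := 2))// ?nnegrE ?(ltW e0)// real_normK ?num_real//.
by apply: le_lt_trans h; rewrite lerDl; apply: sumr_ge0 => j _; exact: sqr_ge0.
Qed.

End weak_star_density.

Lemma tails_proper (D : Type) (le : D -> D -> Prop) :
  directed le -> ProperFilter (tails le).
Proof.
move=> [[a0] le_refl le_trans le_bound]; apply: filter_from_proper; last first.
  by move=> a _; exists a; exact: le_refl.
apply: filter_from_filter; first by exists a0.
move=> a b _ _; have [c [ac bc]] := le_bound a b; exists c => // x cx.
by split; exact: le_trans cx.
Qed.

Theorem proposition3p20 (R : realType) (N : nat) (eps : R) (eps_gt0 : 0 < eps)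
    (Omega : set 'rV[R]_N) (mOmega : measurable Omega)
    (dOmega : domain Omega) (bOmega : bounded_set Omega)
    (cOmega : convex_set (Omega : set (convex_lmodType 'rV[R]_N)))
    (mu : probability ('rV[R]_N * bool)%type R)
    (mu_Omega : mu (Omega `*` [set: bool]) = 1%E)
    (mu_ac : forall i : bool, content_dominates (lebesgue_rV R N) (marginal mu i))
    (rho : bool -> 'rV[R]_N -> R)
    (rho_density : forall i : bool, density Omega (marginal mu i) (rho i))
    (u : Linfty mOmega) (phi : Linfty mOmega -> R) :
  subdiff_TV eps rho u phi <->
  exists nu : {additive_charge set 'rV[R]_N -> \bar R},
    [/\ ba mOmega nu /\
          (forall v : Linfty mOmega, phi v = ba_integral mOmega nu v),
        TV eps mOmega rho u = ba_integral mOmega nu u &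
        exists (D : Type) (le : D -> D -> Prop)
               (Psi : D -> bool -> 'rV[R]_N * 'rV[R]_N -> R),
          [/\ directed le,
              (forall a i, transport_kernels eps Omega (Psi a i)) &
              forall v : Linfty mOmega,
                (- \int[lebesgue_rV R N]_(x in Omega)
                    (v x * div_eps eps Omega (weighted_kernel (Psi a) rho) x))
                  @[a --> tails le] --> ba_integral mOmega nu v]].
Proof.
have oOmega : open Omega by case: dOmega.
have Omegay := lebesgue_bounded_lty mOmega bOmega.
have rhoi i : (lebesgue_rV R N).-integrable Omega (EFin \o rho i).
  by case: (rho_density i).
have rho0 i : \forall x \ae lebesgue_rV R N, Omega x -> 0 <= rho i x.
  apply: (density_ae_ge0 mOmega (rhoi i)) => A mA AO.
  by rewrite -(rho_density i).2// measure_ge0.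
split=> [[[sphi [C phiC]] sub]|[nu [[nuba phiE] uE [D [le [Psi [dle tPsi Psi_nu]]]]]]].
  have uE : phi u = TV eps mOmega rho u.
    (* The subgradient inequality at [2 *: u] gives [phi u <= TV u], and at [2^-1 *: u] the
       reverse. *)
    have := sub (2 *: u); have := sub (2^-1 *: u).
    have := TV_scale_le eps_gt0 oOmega Omegay rhoi rho0 u (ler0n R 2).
    have : (0 : R) <= 2^-1 by rewrite invr_ge0.
    move=> /(TV_scale_le eps_gt0 oOmega Omegay rhoi rho0 u).
    rewrite !(scalarB sphi) !(scalarZ sphi).
    have solve (x y a b : R) : b <= 2^-1 * y -> a <= 2 * y ->
      y + (2^-1 * x - x) <= b -> y + (2 * x - x) <= a -> x = y by lra.
    exact: solve.
  have phi_le v : phi v <= TV eps mOmega rho v.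
    by have := sub v; rewrite (scalarB sphi) uE addrCA subrr addr0.
  exists (charge_of_functional sphi); split.
  - split; first exact: charge_of_functional_ba phiC.
    by move=> v; rewrite (ba_integral_charge_of_functional _ phiC).
  - by rewrite (ba_integral_charge_of_functional _ phiC).
  have e0 (a : seq (Linfty mOmega) * nat) : (0 : R) < a.2.+1%:R^-1.
    by rewrite invr_gt0.
  have /choice[k kP] : forall a : seq (Linfty mOmega) * nat, exists k,
      (forall i, exact_transport_density eps Omega (k i)) /\
      forall v, v \in a.1 -> `|pairing eps Omega rho k v - phi v| < a.2.+1%:R^-1.
    move=> a; have [k ek kphi] := dominated_functional_close eps_gt0 oOmega
      Omegay rhoi rho0 sphi phi_le a.1 (e0 a).
    by exists k.
  pose le (a b : seq (Linfty mOmega) * nat) :=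
    {subset a.1 <= b.1} /\ (a.2 <= b.2)%N.
  have dle : directed le.
    split.
    - exact: (inhabits ([::], 0%N)).
    - by move=> a; split.
    - move=> a b c [ab1 ab2] [bc1 bc2]; split; last exact: leq_trans bc2.
      by move=> v /ab1/bc1.
    - move=> a b; exists (a.1 ++ b.1, maxn a.2 b.2); split; split => /=.
      + by move=> v va; rewrite mem_cat va.
      + exact: leq_maxl.
      + by move=> v vb; rewrite mem_cat vb orbT.
      + exact: leq_maxr.
  exists _, le, k; split => //.
    by move=> a i; apply: exact_transport_kernel => //; exact: (kP a).1.
  move=> v; rewrite (ba_integral_charge_of_functional _ phiC).
  have tle := tails_proper dle.
  apply/cvgrPdist_lt => e egt0; have [n ne] : exists n : nat, n.+1%:R^-1 < e.
    by have /ltr_add_invr[n] := egt0; rewrite add0r; exists n.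
  exists ([:: v], n) => // a [va na] /=; rewrite distrC.
  apply: lt_trans ne; apply: (@lt_le_trans _ _ a.2.+1%:R^-1).
    by apply: (kP a).2; apply: va; rewrite mem_head.
  by rewrite lef_pV2 ?posrE// ler_nat.
have [sI [C IC]] := ba_integral_dual nuba.
have -> : phi = (fun v => ba_integral mOmega nu v) by apply/funext.
split; first by split => //; exists C.
move=> v; rewrite (scalarB sI) uE addrC subrK.
have tle := tails_proper dle.
rewrite -(cvg_lim _ (Psi_nu v))//; apply: limr_le.
  by apply/cvg_ex; eexists; exact: Psi_nu.
by apply: nearW => a; exact: (pairing_le eps_gt0 oOmega rhoi rho0 v (tPsi a)).
Qed.
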